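(* Let $c>0$ be fixed. There exists, for every $n$, a coupling of the random multigraphs $\mathbb G_{\mathrm{PAG}}(n)$ and $\mathbb G_W(n)$ (i.e. a realization of both on a common probability space) such that for these couplings the following holds: for every $1<\alpha<2$ there exists $K(\alpha)>0$ such that for every integer $n\ge 2$ $$\mathbb E\big(d_{\boxtimes}(\mathbb G_{\mathrm{PAG}}(n),\mathbb G_W(n))\big)\le K(\alpha)\cdot \log^2 n\cdot n^{\beta(\alpha)},\qquad \beta(\alpha):=\max\Big\{\alpha-2,\ \frac{1-\alpha}{2},\ -\frac12,\ 4-3\alpha\Big\}.$$ The value of $\alpha\in(1,2)$ minimizing $\beta(\alpha)$ is $\alpha=5/3$, for which $\beta(5/3)=-1/3$.
   Context: The parameter $c>0$ is fixed throughout; constants may depend on $c$. All multigraphs are undirected and have vertex set $[n]=\{1,\dots,n\}$. Jumble norm distance: for multigraphs $G,H$ on $[n]$ with edge multiplicities $U_{ij}=U_{ji}$ in $G$ and $V_{ij}=V_{ji}$ in $H$ ($U_{ii},V_{ii}$ being the number of loops at $i$), $$d_{\boxtimes}(G,H)=\frac1n\max_{\emptyset\ne S,T\subseteq[n]}\frac1{\sqrt{|S|\,|T|}}\Big|\sum_{i\in S,\,j\in T}(U_{ij}-V_{ij})\Big|.$$ $\mathbb G_{\mathrm{PAG}}(n)$: assign an urn to each vertex of $[n]$, initially with one ball in each. For $t=1,2,\dots,\lfloor cn^2\rfloor$, at step $t$ choose an urn with probability proportional to its current number of balls (each choice being conditionally independent of the previous steps given the current distribution of balls) and put one new ball into it.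 Then, for $k=1,\dots,\lfloor\lfloor cn^2\rfloor/2\rfloor$, add an edge between the vertices whose urns received the balls at steps $2k-1$ and $2k$. Multiple edges and loops may occur. $\mathbb G_W(n)$: let $\xi_1,\dots,\xi_n$ be independent exponential random variables with parameter $1$. Conditionally on the $\xi_i$'s, let $Y_{ij}$ ($1\le i<j\le n$) be independent Poisson random variables with parameter $c\xi_i\xi_j$. Put $Y_{ij}$ edges between $i$ and $j$ for every $1\le i<j\le n$; there are no loops. *)

(* Defs.v *)
From HB Require Import structures.
From mathcomp Require Import all_boot all_order all_algebra.
From mathcomp Require Import all_classical all_reals all_analysis.

Set Implicit Arguments.
Unset Strict Implicit.
Unset Printing Implicit Defensive.

Import Order.TTheory GRing.Theory Num.Theory.

Local Open Scope classical_set_scope.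
Local Open Scope ring_scope.

(* A multigraph on 'I_n is its matrix of edge multiplicities; the diagonal
   entry (i, i) is the number of loops at i, each loop being counted once. *)
Record multigraph (n : nat) := Multigraph {
  mult :> 'M[nat]_n;
  mult_sym : mult^T == mult }.

HB.instance Definition _ n := [isSub for @mult n].
HB.instance Definition _ n := [Countable of multigraph n by <:].

Lemma mult_of_fun_sym n (f : 'I_n -> 'I_n -> nat) :
  (forall i j, f i j = f j i) ->
  (\matrix_(i, j) f i j)^T == \matrix_(i, j) f i j.
Proof. by move=> fC; apply/eqP/matrixP => i j; rewrite !mxE. Qed.

Definition multigraph_of_fun n (f : 'I_n -> 'I_n -> nat)
    (fC : forall i j, f i j = f j i) : multigraph n :=
  Multigraph (mult_of_fun_sym fC).

Definition empty_multigraph n : multigraph n :=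
  @multigraph_of_fun n (fun _ _ => 0%N) (fun _ _ => erefl).

HB.instance Definition _ n := isPointed.Build (multigraph n) (empty_multigraph n).

HB.instance Definition _ n := @isMeasurable.Build default_measure_display
  (multigraph n) discrete_measurable discrete_measurable0
  discrete_measurableC discrete_measurableU.

(* The base value 0 of the maxima is harmless, all the terms being
   nonnegative. *)
Definition jumble_dist (R : realType) n (G H : multigraph n) : R :=
  n%:R^-1 *
  \big[Num.max/0]_(S : {set 'I_n} | S != finset.set0)
    \big[Num.max/0]_(T : {set 'I_n} | T != finset.set0)
      ((Num.sqrt (#|S|%:R * #|T|%:R))^-1 *
       `| \sum_(i in S) \sum_(j in T) ((G i j)%:R - (H i j)%:R) |).

(* Draws are indexed from 0, so that X t is the urn receiving the ball at
   step t + 1. *)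

Definition balls n (w : nat -> 'I_n) (t : nat) (v : 'I_n) : nat :=
  (1 + \sum_(s < t) (w s == v))%N.

Definition history (T : Type) n (X : nat -> T -> 'I_n) (w : nat -> 'I_n)
    (t : nat) : set T :=
  [set x | forall s, (s < t)%N -> X s x = w s].

(* The conditional law of each of the first N draws given the whole past is
   proportional to the current numbers of balls; X t is unconstrained for
   t >= N. *)
Definition urn_process (R : realType) (d : measure_display)
    (T : measurableType d) (P : probability T R) n (N : nat)
    (X : nat -> T -> 'I_n) : Prop :=
  (forall t v, (t < N)%N -> measurable (X t @^-1` [set v])) /\
  (forall t w v, (t < N)%N ->
    P (history X w t `&` X t @^-1` [set v]) =
    (P (history X w t) *
     ((balls w t v)%:R / (\sum_(u < n) balls w t u)%N%:R)%:E)%E).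

Definition is_edge n (u v i j : 'I_n) : bool :=
  ((i == u) && (j == v)) || ((i == v) && (j == u)).

Definition pag_mult n (N : nat) (w : nat -> 'I_n) (i j : 'I_n) : nat :=
  (\sum_(k < N./2) is_edge (w k.*2) (w k.*2.+1) i j)%N.

Lemma pag_multC n N (w : nat -> 'I_n) i j : pag_mult N w i j = pag_mult N w j i.
Proof.
by apply: eq_bigr => k _; rewrite /is_edge orbC andbC [in X in _ || X]andbC.
Qed.

Definition pag_multigraph n N (w : nat -> 'I_n) : multigraph n :=
  multigraph_of_fun (pag_multC N w).

Definition pag_law (R : realType) (c : R) (d : measure_display)
    (T : measurableType d) (P : probability T R) n
    (G : {RV P >-> multigraph n}) : Prop :=
  exists (d' : measure_display) (T' : measurableType d')
    (P' : probability T' R) (X : nat -> T' -> 'I_n),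
    let N := Num.truncn (c * n%:R ^+ 2) in
    urn_process P' N X /\
    distribution P G =1
      pushforward P' (fun x => pag_multigraph N (fun t => X t x)).

Definition mutually_independent (R : realType) (d : measure_display)
    (T : measurableType d) (P : probability T R) n
    (xi : 'I_n -> {RV P >-> R}) : Prop :=
  forall (J : {set 'I_n}) (B : 'I_n -> set R),
    (forall i, measurable (B i)) ->
    P [set x | forall i, i \in J -> B i (xi i x)] =
    (\prod_(i in J) P (xi i @^-1` B i))%E.

(* Only the Y i j with i < j are used. *)
Definition w_mult n (Y : 'I_n -> 'I_n -> nat) (i j : 'I_n) : nat :=
  if (i < j)%N then Y i j else if (j < i)%N then Y j i else 0%N.

Lemma w_multC n (Y : 'I_n -> 'I_n -> nat) i j : w_mult Y i j = w_mult Y j i.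
Proof. by rewrite /w_mult; case: ltngtP. Qed.

Definition w_multigraph n (Y : 'I_n -> 'I_n -> nat) : multigraph n :=
  multigraph_of_fun (w_multC Y).

(* Conditionally on the sigma-algebra generated by xi, the Y i j, i < j, are
   independent Poisson variables with parameters c * xi i * xi j: the
   conditional probability of {Y i j = k i j for all i < j} is the product of
   the Poisson masses.  The values of poisson_pmf at nonpositive rates do not
   matter when the xi i are exponential, hence almost surely positive. *)
Definition conditionally_poisson (R : realType) (c : R) (d : measure_display)
    (T : measurableType d) (P : probability T R) n
    (xi : 'I_n -> {RV P >-> R}) (Y : 'I_n -> 'I_n -> {RV P >-> nat}) : Prop :=
  forall (E : set T) (k : 'I_n -> 'I_n -> nat),
    g_sigma_preimage (fun i => xi i : T -> R) E ->
    P (E `&` [set x | forall i j : 'I_n, (i < j)%N -> Y i j x = k i j]) =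
    (\int[P]_(x in E)
       (\prod_(i < n) \prod_(j < n | (i < j)%N)
          poisson_pmf (c * xi i x * xi j x) (k i j))%:E)%E.

Definition w_law (R : realType) (c : R) (d : measure_display)
    (T : measurableType d) (P : probability T R) n
    (H : {RV P >-> multigraph n}) : Prop :=
  exists (d' : measure_display) (T' : measurableType d')
    (P' : probability T' R)
    (xi : 'I_n -> {RV P' >-> R}) (Y : 'I_n -> 'I_n -> {RV P' >-> nat}),
    [/\ forall i (B : set R), measurable B ->
          distribution P' (xi i) B = exponential_prob 1 B,
        mutually_independent xi,
        conditionally_poisson c xi Y &
        distribution P H =1
          pushforward P' (fun x => w_multigraph (fun i j => Y i j x))].

Definition beta_exponent (R : realType) (a : R) : R :=
  Num.max (Num.max (a - 2) ((1 - a) / 2)) (Num.max (- (1 / 2)) (4 - 3 * a)).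

(* Main.v *)
Require Import Defs.
From HB Require Import structures.
From mathcomp Require Import all_boot all_order all_algebra.
From mathcomp Require Import all_classical all_reals all_analysis.
From mathcomp Require Import measurable_realfun ring lra.

(* Given xi, the draws of the urn are independent with law p = xi / S, where
   S is the sum of the xi i, and p is independent of S.  The W-graph together
   with Poisson(c xi_i^2 / 2) loops at each i consists, given xi, of a
   Poisson(c S^2 / 2) number m of edges whose endpoints are independent with
   law p.  So both graphs can be read off one urn sequence drawn independently
   of m: the urn graph is made of its first M = N./2 pairs, N being the number
   of draws, and the W-graph of its first m pairs, minus the loops.  Then n
   times the jumble distance is at most the largest degree in the difference,
   that is, in |m - M| = O(n^(3/2)) exchangeable pairs and in the loops of the
   urn graph.  Sixth moments of the degrees and second moments of the numbers
   of loops bound its expectation by O(n^(2/3)), hence the mean distance by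
   O(n^(-1/3)), and -1/3 is the least value of the exponent beta. *)

Set Implicit Arguments.
Unset Strict Implicit.
Unset Printing Implicit Defensive.

Import Order.TTheory GRing.Theory Num.Theory.
Import numFieldNormedType.Exports.

Local Open Scope classical_set_scope.
Local Open Scope ring_scope.

(** * Exponential and gamma integrals *)

(** Normalized exponential variables are uniform on the simplex, and sampling letters independently
    from such a [p] gives a word the probability of a product of factorials over a rising factorial.
    This is also the law of the urn started with one ball of each kind, so [xi] can be integrated
    out. Only the laws of the two graphs are prescribed, hence the coupling lives on the countable
    space of couples ([m], word). The [xi] survive only on an auxiliary space that identifies the
    law of the W-graph. The order n^(3/2) of |m - M| comes from S: it deviates from n by about
    n^(1/2), so c S^2 / 2 deviates by about n^(3/2), while the Poisson noise is only of order n. A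
    window of k letters gives each vertex a degree of order 1 + k/n, here n^(1/2), and a maximum
    over n vertices controlled by q-th moments costs a further n^(1/q). The target n^(2/3) therefore
    asks for q = 6. The number of loops at a vertex has a bounded second moment, so its maximum
    costs only n^(1/2). *)

Section density.
Local Open Scope ereal_scope.
Context d (T : measurableType d) (R : realType).
Variables (mu nu : {measure set T -> \bar R}) (h : T -> R).
Hypothesis mh : measurable_fun [set: T] h.
Hypothesis h0 : forall x, (0 <= h x)%R.
Hypothesis nuE : forall A, measurable A -> nu A = \int[mu]_(x in A) (h x)%:E.

Import HBNNSimple.

Lemma ge0_integral_density (f : T -> \bar R) :
  measurable_fun [set: T] f -> (forall x, 0 <= f x) ->
  \int[nu]_x f x = \int[mu]_x (f x * (h x)%:E).
Proof.
move=> mf f0; pose f_ := nnsfun_approx measurableT mf.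
have cvgf x : (fun n => (f_ n x)%:E) @ \oo --> f x.
  by apply: cvg_nnsfun_approx.
transitivity (limn (fun n => \int[nu]_x (f_ n x)%:E)).
  rewrite -monotone_convergence//.
  - by apply: eq_integral => x _; apply/esym/cvg_lim => //; exact: cvgf.
  - by move=> n; exact/measurable_EFinP/measurable_funTS.
  - by move=> *; rewrite lee_fin.
  - by move=> x _ m n mn; rewrite lee_fin; exact/lefP/nd_nnsfun_approx.
transitivity (limn (fun n => \int[mu]_x ((f_ n x)%:E * (h x)%:E))); last first.
  rewrite -monotone_convergence//.
  - apply: eq_integral => x _; apply/cvg_lim => //.
    by apply: cvgeZr => //; exact: cvgf.
  - move=> n; apply: emeasurable_funM; last exact/measurable_EFinP.
    exact/measurable_EFinP/measurable_funTS.
  - by move=> n x _; rewrite mule_ge0// lee_fin.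
  - move=> x _ m n mn; apply: lee_wpmul2r; rewrite ?lee_fin//.
    exact/lefP/nd_nnsfun_approx.
congr (limn _); apply/funext => n.
under eq_integral do rewrite fimfunE// -fsumEFin//.
rewrite ge0_integral_fsum//; last 2 first.
  - by move=> r; exact/measurable_EFinP/measurableT_comp.
  - by move=> r x _; rewrite nnfun_muleindic_ge0.
under [RHS]eq_integral.
  move=> x _; rewrite fimfunE// -fsumEFin// ge0_mule_fsuml; last first.
    by move=> r; rewrite nnfun_muleindic_ge0.
  over.
rewrite ge0_integral_fsum//; last 2 first.
  - move=> r; apply: emeasurable_funM; last exact/measurable_EFinP.
    exact/measurable_EFinP/measurableT_comp.
  - by move=> r x _; rewrite mule_ge0 ?lee_fin// -lee_fin EFinM nnfun_muleindic_ge0.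
apply: eq_fsbigr => r _; rewrite integralZl_indic_nnsfun// integral_indic// setIT.
rewrite nuE//.
have [r0|r0] := leP 0%R r; last first.
  rewrite preimage_nnfun0//.
  rewrite integral_set0 mule0 integral0_eq// => x _.
  by rewrite indic0 mulr0 mul0e.
rewrite -ge0_integralZl_EFin//; last 2 first.
  - by move=> x _; rewrite lee_fin.
  - exact/measurable_EFinP/measurable_funTS.
rewrite [LHS]integral_mkcond; apply: eq_integral => x _.
by rewrite patchE indicE; case: ifPn; rewrite ?mulr1// mulr0 mul0e.
Qed.

End density.

Section mdensity.
Local Open Scope ereal_scope.
Context d (T : measurableType d) (R : realType).
Variables (mu : {measure set T -> \bar R}) (h : T -> R).

(* The proofs are arguments only so that the measure instance is found by
   unification. *)
Definition mdensity (mh : measurable_fun [set: T] h)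
  (h0 : forall x, (0 <= h x)%R) (A : set T) : \bar R :=
  \int[mu]_(x in A) (h x)%:E.

Hypothesis mh : measurable_fun [set: T] h.
Hypothesis h0 : forall x, (0 <= h x)%R.

Let mdensity0 : mdensity mh h0 set0 = 0.
Proof. by rewrite /mdensity integral_set0. Qed.

Let mdensity_ge0 A : 0 <= mdensity mh h0 A.
Proof. by apply: integral_ge0 => x _; rewrite lee_fin. Qed.

Let mdensity_sigma_additive : semi_sigma_additive (mdensity mh h0).
Proof.
move=> F mF tF mUF; rewrite /mdensity; apply: cvg_toP.
  apply: ereal_nondecreasing_is_cvgn => m n mn.
  by apply: lee_sum_nneg_natr => // k _ _; exact: mdensity_ge0.
rewrite ge0_integral_bigcup//.
- exact/measurable_EFinP/measurable_funTS.
- by move=> x _; rewrite lee_fin.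
Qed.

HB.instance Definition _ := isMeasure.Build _ _ _ (mdensity mh h0)
  mdensity0 mdensity_ge0 mdensity_sigma_additive.

End mdensity.

Section translation.
Local Open Scope ereal_scope.
Context {R : realType}.
Local Notation mu := (@lebesgue_measure R).

Lemma lebesgue_measureD (a : R) (A : set R) : measurable A ->
  pushforward mu ((fun x => a + x)%R : _ -> measurableTypeR R) A = mu A.
Proof.
move=> mA.
have mD : measurable_fun setT ((fun x => a + x)%R : R -> measurableTypeR R).
  exact: measurable_funD.
apply/esym/lebesgue_measure_unique => //= _ [[x y]] _ <-.
rewrite /pushforward (_ : _ @^-1` _ = `](x - a)%R, (y - a)%R]%classic); last first.
  by apply/seteqP; split => z /=; rewrite !in_itv/= ltrBlDl lerBrDl.
rewrite !lebesgue_measure_itv/= !lte_fin ltrD2r; case: ltP => // _.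
by rewrite !EFinB; congr EFin; lra.
Qed.

Lemma ge0_integral_translation (a : R) (f : R -> \bar R) :
  measurable_fun [set: R] f -> (forall x, 0 <= f x) ->
  \int[mu]_x f (a + x)%R = \int[mu]_x f x.
Proof.
move=> mf f0.
have mD : measurable_fun setT ((fun x => a + x)%R : R -> measurableTypeR R).
  exact: measurable_funD.
transitivity (\int[pushforward mu ((fun x => a + x)%R : R -> measurableTypeR R)]_x f x).
  by rewrite ge0_integral_pushforward.
  by apply: eq_measure_integral => //= A mA AS; exact: lebesgue_measureD.
Qed.

End translation.

Section gamma.
Context {R : realType}.
Local Notation mu := (@lebesgue_measure R).
Implicit Types (f : R -> \bar R) (k : nat).

(** The gamma density of shape [k + 1] and rate 1: the index is the exponent of [s], one less than
    the number of exponential summands. *)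
Definition gamma_pdf k (s : R) : R := s ^+ k / k`!%:R * exponential_pdf 1 s.

Lemma exp1_pdfE (s : R) : exponential_pdf 1 s = if 0 <= s then expR (- s) else 0.
Proof.
case: ifPn => [s0|]; first by rewrite exponential_pdfE// mulN1r mul1r.
by rewrite -ltNge => /lt0_exponential_pdf.
Qed.

Lemma gamma_pdf_ge0 k s : 0 <= gamma_pdf k s.
Proof.
rewrite /gamma_pdf exp1_pdfE; case: ifPn => s0; last by rewrite mulr0.
by rewrite mulr_ge0 ?expR_ge0// divr_ge0// exprn_ge0.
Qed.

Lemma measurable_gamma_pdf k : measurable_fun [set: R] (gamma_pdf k).
Proof.
apply: measurable_funM; last exact: measurable_exponential_pdf.
by apply: measurable_funM => //; exact: measurable_funX.
Qed.

Lemma gamma_pdf0 s : gamma_pdf 0 s = exponential_pdf 1 s.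
Proof. by rewrite /gamma_pdf expr0 fact0 divr1 mul1r. Qed.

Local Open Scope ereal_scope.

(** On [[0, u]] the exponentials multiply to the constant [expR (- u)], so only the primitive of a
    power is left; outside, one of the two factors vanishes. The case [u = 0] is treated apart
    because the fundamental theorem is applied on a nondegenerate interval. *)
Lemma gamma_convolution k (u : R) :
  \int[mu]_x (gamma_pdf 0 (u - x) * gamma_pdf k x)%:E = (gamma_pdf k.+1 u)%:E.
Proof.
have [u0|u0] := ltP u 0%R.
  rewrite integral0_eq => [|x _].
    by rewrite /gamma_pdf exp1_pdfE leNgt u0 mulr0.
  congr EFin; rewrite /gamma_pdf !exp1_pdfE.
  have [x0|x0] := leP 0%R x; last by rewrite !mulr0.
  by rewrite ifF ?mulr0 ?mul0r//; apply/negbTE; rewrite -ltNge; lra.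
transitivity (\int[mu]_(x in `[0%R, u]) (x ^+ k / k`!%:R * expR (- u))%:E).
  rewrite [RHS]integral_mkcond; apply: eq_integral => x _.
  rewrite patchE /gamma_pdf !exp1_pdfE expr0 fact0 divr1 mul1r.
  rewrite mem_setE in_itv/= subr_ge0.
  case: (leP 0%R x) => x0/=; last by rewrite !mulr0.
  case: (leP x u) => xu; last by rewrite mul0r.
  rewrite mulrCA -expRD; congr (_ * expR _)%:E; ring.
have [->|u1] := eqVneq u 0%R.
  rewrite set_itv1 integral_set1 /gamma_pdf exprS mul0r mul0r mul0r//.
have {u0 u1}u0 : (0 < u)%R by rewrite lt_neqAle eq_sym u1.
pose F (x : R) : R := (x ^+ k.+1 * (k.+1`!%:R^-1 * expR (- u)))%R.
have dF x : is_derive x (1%R : R) F (x ^+ k / k`!%:R * expR (- u))%R.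
  have -> : F = ((k.+1`!%:R^-1 * expR (- u)) \*: ((id : R -> R) ^+ k.+1))%R.
    by apply/funext => y; rewrite /F exprfctE mulrC.
  apply: is_derive_eq.
  rewrite /GRing.scale/= mulr1 factS natrM; field.
  by rewrite nat1r !pnatr_eq0 -lt0n fact_gt0.
rewrite (@continuous_FTC2 _ _ F)//.
- rewrite (_ : F 0%R = 0%R) ?sube0; last by rewrite /F exprS !mul0r.
  by rewrite /F /gamma_pdf exp1_pdfE (ltW u0) mulrA.
- apply: continuous_subspaceT => x; apply: cvgM; last exact: cvg_cst.
  by apply: cvgM; [exact: exprn_continuous|exact: cvg_cst].
- have cF x : {for x, continuous F}.
    by apply/differentiable_continuous/derivable1_diffP; exact: ex_derive.
  split; first by move=> x _; exact: ex_derive.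
  + by apply: cvg_at_right_filter; exact: cF.
  + by apply: cvg_at_left_filter; exact: cF.
- by move=> x _; rewrite derive1E derive_val.
Qed.

Definition gamma_int k f := \int[mu]_s (f s * (gamma_pdf k s)%:E).

(* The expectation of f (x + E) for an exponential variable E. *)
Definition exp_shift f x := \int[mu]_s (f (x + s)%R * (gamma_pdf 0 s)%:E).

Lemma gamma_int_ge0 k f : (forall x, 0 <= f x) -> 0 <= gamma_int k f.
Proof.
by move=> f0; apply: integral_ge0 => x _; rewrite mule_ge0 ?lee_fin ?gamma_pdf_ge0.
Qed.

Lemma exp_shift_ge0 f x : (forall x, 0 <= f x) -> 0 <= exp_shift f x.
Proof.
by move=> f0; apply: integral_ge0 => s _; rewrite mule_ge0 ?lee_fin ?gamma_pdf_ge0.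
Qed.

Lemma exp_shiftD f x y : exp_shift (fun z => f (x + z)%R) y = exp_shift f (x + y)%R.
Proof. by rewrite /exp_shift; under eq_integral do rewrite addrA. Qed.

Lemma exp_shift0 f : exp_shift f 0%R = gamma_int 0 f.
Proof. by rewrite /exp_shift; under eq_integral do rewrite add0r. Qed.

Lemma measurable_exp_shift f : measurable_fun [set: R] f ->
  (forall x, 0 <= f x) -> measurable_fun [set: R] (exp_shift f).
Proof.
move=> mf f0.
apply: (@measurable_fun_fubini_tonelli_F _ _ _ _ _ mu
  (fun z : R * R => f (z.1 + z.2)%R * (gamma_pdf 0 z.2)%:E)).
  apply: emeasurable_funM.
    by apply: measurableT_comp => //; exact: measurable_funD.
  by apply/measurable_EFinP; apply: measurableT_comp => //; exact: measurable_gamma_pdf.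
by move=> z; rewrite mule_ge0 ?lee_fin ?gamma_pdf_ge0.
Qed.

Lemma exp_shiftE f x : measurable_fun [set: R] f -> (forall x, 0 <= f x) ->
  exp_shift f x = \int[mu]_u (f u * (gamma_pdf 0 (u - x))%:E).
Proof.
move=> mf f0.
rewrite -(@ge0_integral_translation _ x (fun u => f u * (gamma_pdf 0 (u - x))%:E)).
- by apply: eq_integral => s _; rewrite [(x + s - x)%R]addrAC subrr add0r.
- apply: emeasurable_funM => //; apply/measurable_EFinP.
  by apply: measurableT_comp; [exact: measurable_gamma_pdf|exact: measurable_funB].
- by move=> u; rewrite mule_ge0 ?lee_fin ?gamma_pdf_ge0.
Qed.

(** After the substitution [u = x + s], Tonelli puts the integral over [x] inside, where it is the
    convolution of the two densities. *)
Lemma gamma_int_exp_shift k f : measurable_fun [set: R] f ->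
  (forall x, 0 <= f x) -> gamma_int k (exp_shift f) = gamma_int k.+1 f.
Proof.
move=> mf f0.
pose h (z : R * R) := f z.2 * (gamma_pdf 0 (z.2 - z.1) * gamma_pdf k z.1)%:E.
have h0 z : 0 <= h z.
  by rewrite mule_ge0// lee_fin mulr_ge0// gamma_pdf_ge0.
have mg : measurable_fun setT
    (fun z : R * R => (gamma_pdf 0 (z.2 - z.1) * gamma_pdf k z.1)%R).
  apply: measurable_funM.
    by apply: measurableT_comp; [exact: measurable_gamma_pdf|exact: measurable_funB].
  by apply: measurableT_comp => //; exact: measurable_gamma_pdf.
have mh : measurable_fun setT h.
  by apply: emeasurable_funM; [exact: measurableT_comp|exact/measurable_EFinP].
transitivity (\int[mu]_x \int[mu]_u h (x, u)).
  apply: eq_integral => x _; rewrite exp_shiftE// -ge0_integralZr//.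
  - by apply: eq_integral => u _; rewrite /h/= -muleA -EFinM.
  - apply: emeasurable_funM => //; apply/measurable_EFinP.
    by apply: measurableT_comp; [exact: measurable_gamma_pdf|exact: measurable_funB].
  - by move=> u _; rewrite mule_ge0 ?lee_fin ?gamma_pdf_ge0.
  - by rewrite lee_fin gamma_pdf_ge0.
rewrite (@fubini_tonelli _ _ _ _ _ mu mu h mh h0).
apply: eq_integral => u _; rewrite -gamma_convolution.
rewrite -ge0_integralZl//.
- apply/measurable_EFinP; apply: (measurableT_comp mg (pair2_measurable u)).
- by move=> x _; rewrite lee_fin mulr_ge0 ?gamma_pdf_ge0.
Qed.

(* A gamma variable is a sum of independent exponential variables. *)
Lemma gamma_int_iter k f : measurable_fun [set: R] f ->
  (forall x, 0 <= f x) -> gamma_int k f = iter k.+1 exp_shift f 0%R.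
Proof.
elim: k f => [|k IH] f mf f0; first by rewrite -exp_shift0.
rewrite -gamma_int_exp_shift// IH//.
- by rewrite -iterSr.
- exact: measurable_exp_shift.
- by move=> x; exact: exp_shift_ge0.
Qed.

Lemma gamma_int1 k : gamma_int k (cst 1) = 1.
Proof.
have shift1 : exp_shift (cst 1) = cst 1.
  apply/funext => x; rewrite /exp_shift.
  under eq_integral do rewrite mul1e gamma_pdf0.
  exact: integral_exponential_pdf.
elim: k => [|k IH]; first by rewrite -exp_shift0 shift1.
by rewrite -gamma_int_exp_shift// shift1.
Qed.

End gamma.

(** * Independent samples and exponential coordinates *)

Section iid.
Local Open Scope ereal_scope.
Context d (T : measurableType d) (R : realType) (P : probability T R).

Definition tuple_cons n (z : T * n.-tuple T) : n.+1.-tuple T :=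
  [the n.+1.-tuple T of z.1 :: z.2].

Lemma measurable_tuple_cons n : measurable_fun [set: T * n.-tuple T] (@tuple_cons n).
Proof. exact: measurable_cons. Qed.

HB.instance Definition _ n :=
  isMeasurableFun.Build _ _ _ _ (@tuple_cons n) (@measurable_tuple_cons n).

(** The recursion adds one coordinate in front, so that Tonelli splits off the first coordinate in
    inductions on [n]. *)
Fixpoint iid_prob n : probability (n.-tuple T) R :=
  match n with
  | 0 => \d_[tuple]
  | n'.+1 => distribution (P \x iid_prob n') (@tuple_cons n')
  end.

Lemma ge0_integral_iid_probS n (f : n.+1.-tuple T -> \bar R) :
  measurable_fun [set: n.+1.-tuple T] f -> (forall t, 0 <= f t) ->
  \int[iid_prob n.+1]_t f t = \int[P]_x \int[iid_prob n]_t f (tuple_cons (x, t)).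
Proof.
move=> mf f0.
transitivity (\int[P \x iid_prob n]_z f (tuple_cons z)).
  by rewrite -(ge0_integral_distribution (@tuple_cons n)).
rewrite fubini_tonelli1//.
by apply: measurableT_comp => //; exact: measurable_tuple_cons.
Qed.

Lemma iid_prob_rectangle n (B : 'I_n -> set T) : (forall i, measurable (B i)) ->
  iid_prob n [set t | forall i, B i (tnth t i)] = \prod_(i < n) P (B i).
Proof.
elim: n B => [|n IH] B mB.
  by rewrite big_ord0 /= diracE mem_set// => -[].
rewrite big_ord_recl /= /distribution /pushforward.
rewrite (_ : _ @^-1` _ = B ord0 `*`
    [set t | forall i : 'I_n, B (lift ord0 i) (tnth t i)]); last first.
  apply/seteqP; split => [[x t] /= H|[x t] /= [H0 H] i].
    by split; [exact: (H ord0)|move=> i; have := H (lift ord0 i); rewrite tnthS].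
  by case: (unliftP ord0 i) => [j|] ->; rewrite ?tnthS//; exact: H.
rewrite product_measure1E//; first by congr (_ * _); apply: IH => i; exact: mB.
rewrite (_ : [set t | _] = \big[setI/setT]_(i < n)
    ((fun t => tnth t i) @^-1` B (lift ord0 i))); last first.
  apply/seteqP; split => [t /= H|t].
    by rewrite -bigcap_seq => i _; exact: H.
  by rewrite -bigcap_seq => H i; apply: H => /=; rewrite mem_index_enum.
apply: bigsetI_measurable => i _; rewrite -[X in measurable X]setTI.
exact: measurable_tnth.
Qed.

End iid.

Section exponential_sample.
Context {R : realType}.
Local Notation mu := (@lebesgue_measure R).
Local Open Scope ereal_scope.

Let pdf_ge0 (x : R) : (0 <= exponential_pdf 1 x)%R.
Proof. exact: exponential_pdf_ge0. Qed.

Let exp1_density := mdensity mu (measurable_exponential_pdf 1) pdf_ge0.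

Definition exp1 : set R -> \bar R := exponential_prob 1.

Let exp10 : exp1 set0 = 0.
Proof. exact: (measure0 exp1_density). Qed.

Let exp1_ge0 A : 0 <= exp1 A.
Proof. exact: (measure_ge0 exp1_density). Qed.

Let exp1_sigma_additive : semi_sigma_additive exp1.
Proof. exact: (@measure_semi_sigma_additive _ _ _ exp1_density). Qed.

HB.instance Definition _ :=
  isMeasure.Build _ _ _ exp1 exp10 exp1_ge0 exp1_sigma_additive.

Let exp1_setT : exp1 setT = 1.
Proof. exact: integral_exponential_pdf. Qed.

HB.instance Definition _ := Measure_isProbability.Build _ _ _ exp1 exp1_setT.

Lemma ge0_integral_exp1 (f : R -> \bar R) : measurable_fun [set: R] f ->
  (forall x, 0 <= f x) ->
  \int[exp1]_x f x = \int[mu]_x (f x * (exponential_pdf 1 x)%:E).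
Proof.
move=> mf f0.
have mid : measurable_fun setT (idfun : measurableTypeR R -> R).
  by move=> _ A mA; rewrite setTI.
transitivity (\int[pushforward exp1_density (idfun : measurableTypeR R -> R)]_x f x).
  exact: eq_measure_integral.
rewrite (ge0_integral_pushforward mid)//.
exact: (@ge0_integral_density _ _ R mu exp1_density _
  (measurable_exponential_pdf 1) pdf_ge0 (fun A mA => erefl) f mf f0).
Qed.

Lemma measurable_iter_exp_shift k (f : R -> \bar R) :
  measurable_fun [set: R] f -> (forall x, 0 <= f x) ->
  measurable_fun [set: R] (iter k exp_shift f).
Proof.
move=> mf f0; suff [] : measurable_fun [set: R] (iter k exp_shift f) /\
    forall x, 0 <= iter k exp_shift f x by [].
elim: k => [//|k [mk k0]] /=; split; first exact: measurable_exp_shift.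
by move=> x; exact: exp_shift_ge0.
Qed.

Lemma iter_exp_shift_ge0 k (f : R -> \bar R) x : (forall x, 0 <= f x) ->
  0 <= iter k exp_shift f x.
Proof.
by move=> f0; elim: k x => [//|k IH] x /=; exact: exp_shift_ge0.
Qed.

Lemma iter_exp_shiftD k (f : R -> \bar R) x :
  iter k exp_shift (fun s => f (x + s)%R) = (fun y => iter k exp_shift f (x + y)%R).
Proof.
by elim: k => [//|k IH] /=; rewrite IH; apply/funext => y; rewrite exp_shiftD.
Qed.

(* Absolute values keep the integrands nonnegative everywhere; they change
   nothing almost surely. *)
Definition norm_sum n (t : n.-tuple R) : R := (\sum_(i < n) `|tnth t i|)%R.

Lemma measurable_norm_sum n : measurable_fun [set: n.-tuple R] (@norm_sum n).
Proof.
apply: measurable_sum => i; apply: measurableT_comp => //.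
exact: measurable_tnth.
Qed.

Definition monomial n (b : 'I_n -> nat) (t : n.-tuple R) : R :=
  (\prod_(i < n) `|tnth t i| ^+ b i)%R.

Lemma monomial_ge0 n (b : 'I_n -> nat) t : (0 <= monomial b t)%R.
Proof. by apply: prodr_ge0 => i _; rewrite exprn_ge0. Qed.

Lemma measurable_monomial n (b : 'I_n -> nat) :
  measurable_fun [set: n.-tuple R] (monomial b).
Proof.
apply: measurable_prod => i _; apply: measurable_funX.
by apply: measurableT_comp => //; exact: measurable_tnth.
Qed.

Lemma norm_sum_cons n (x : R) (t : n.-tuple R) :
  norm_sum (tuple_cons (x, t)) = (`|x| + norm_sum t)%R.
Proof.
rewrite /norm_sum big_ord_recl; congr (_ + _)%R.
by apply: eq_bigr => i _; rewrite tnthS.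
Qed.

Lemma monomial_cons n (b : 'I_n.+1 -> nat) (x : R) (t : n.-tuple R) :
  monomial b (tuple_cons (x, t)) =
  (`|x| ^+ b ord0 * monomial (fun i => b (lift ord0 i)) t)%R.
Proof.
rewrite /monomial big_ord_recl; congr (_ * _)%R.
by apply: eq_bigr => i _; rewrite tnthS.
Qed.

(* The right-hand side depends on b only through its factorials and its sum:
   this yields the independence of S and p, and the law of the urn. *)
Lemma integral_monomial n (b : 'I_n -> nat) (f : R -> \bar R) :
  measurable_fun [set: R] f -> (forall x, 0 <= f x) ->
  \int[iid_prob exp1 n]_t (f (norm_sum t) * (monomial b t)%:E) =
  ((\prod_(i < n) (b i)`!)%N%:R)%:E *
    iter (\sum_(i < n) b i + n) exp_shift f 0%R.
Proof.
elim: n b f => [|n IH] b f mf f0.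
  rewrite !big_ord0 /= integral_dirac//.
    by rewrite diracT/= /norm_sum /monomial !big_ord0 mul1e mul1e mule1.
  apply: emeasurable_funM.
    by apply: measurableT_comp => //; exact: measurable_norm_sum.
  by apply/measurable_EFinP; exact: measurable_monomial.
rewrite ge0_integral_iid_probS//; last 2 first.
- apply: emeasurable_funM.
    by apply: measurableT_comp => //; exact: measurable_norm_sum.
  by apply/measurable_EFinP; exact: measurable_monomial.
- by move=> t; rewrite mule_ge0// lee_fin monomial_ge0.
set b' := fun i => b (lift ord0 i).
set K := (\sum_(i < n) b' i + n)%N.
set B := (\prod_(i < n) (b' i)`!)%N.
transitivity (\int[exp1]_x
    ((B%:R)%:E * (iter K exp_shift f `|x|%R * (`|x| ^+ b ord0)%:E))).
  apply: eq_integral => x _.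
  under eq_integral.
    move=> t _; rewrite norm_sum_cons monomial_cons -/b' EFinM muleCA; over.
  (* The induction hypothesis is used for [f] translated by the first coordinate, and the
     translation then passes through the shifts. *)
  have mfx : measurable_fun setT (fun s => f (`|x| + s)%R).
    by apply: measurableT_comp => //; exact: measurable_funD.
  rewrite ge0_integralZl//; last 2 first.
  - apply: emeasurable_funM.
      by apply: (measurableT_comp mfx); exact: measurable_norm_sum.
    by apply/measurable_EFinP; exact: measurable_monomial.
  - by move=> t _; rewrite mule_ge0// lee_fin monomial_ge0.
  rewrite (IH b' _ mfx)// iter_exp_shiftD addr0.
  by rewrite muleC muleA.
have mK : measurable_fun setT
    (fun x : R => iter K exp_shift f `|x|%R * (`|x| ^+ b ord0)%:E).
  apply: emeasurable_funM; last exact/measurable_EFinP/measurable_funX.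
  apply: measurableT_comp => //; exact: measurable_iter_exp_shift.
have K0 (x : R) : 0 <= iter K exp_shift f `|x|%R * (`|x| ^+ b ord0)%:E.
  by rewrite mule_ge0 ?lee_fin ?exprn_ge0//; exact: iter_exp_shift_ge0.
rewrite ge0_integralZl// ge0_integral_exp1//.
(* Up to the factor [b!], the power [x ^ b] turns the exponential density into the gamma density of
   shape [b + 1]. This coordinate thus contributes [b!] and [b + 1] further shifts. *)
transitivity ((B%:R)%:E *
    (((b ord0)`!%:R)%:E * gamma_int (b ord0) (iter K exp_shift f))).
  congr (_ * _); rewrite /gamma_int -ge0_integralZl//; last 2 first.
  - apply: emeasurable_funM; first exact: measurable_iter_exp_shift.
    by apply/measurable_EFinP; exact: measurable_gamma_pdf.
  - move=> x _; rewrite mule_ge0 ?lee_fin ?gamma_pdf_ge0//.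
    exact: iter_exp_shift_ge0.
  apply: eq_integral => x _; rewrite /gamma_pdf exp1_pdfE.
  have [x0|x0] := leP 0%R x; last by rewrite !(mulr0,mule0).
  rewrite ger0_norm// -muleA -EFinM muleCA -EFinM; congr (_ * _%:E).
  by field; rewrite pnatr_eq0 -lt0n fact_gt0.
rewrite gamma_int_iter//; last 2 first.
- exact: measurable_iter_exp_shift.
- by move=> x; exact: iter_exp_shift_ge0.
have -> : (\prod_(i < n.+1) (b i)`! = (b ord0)`! * B)%N by rewrite big_ord_recl.
have -> : (\sum_(i < n.+1) b i + n.+1 = (b ord0).+1 + K)%N.
  by rewrite big_ord_recl /K addnS addSn addnA.
by rewrite iterD muleA -EFinM -natrM mulnC.
Qed.

End exponential_sample.

(** * Words drawn from the urn *)

Section tuple_sums.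
Context (T : finType) (V : nmodType).

Lemma sum_tuple0 (F : seq T -> V) : \sum_(u : 0.-tuple T) F u = F [::].
Proof.
rewrite (bigD1 [tuple])//= big1 ?addr0// => u.
by rewrite tuple0.
Qed.

Lemma sum_tupleS L (F : seq T -> V) :
  \sum_(u : L.+1.-tuple T) F u = \sum_(v : T) \sum_(u : L.-tuple T) F (v :: u).
Proof.
rewrite pair_big (reindex (fun p : T * L.-tuple T => [tuple of p.1 :: p.2]))//=.
exists (fun u => (thead u, [tuple of behead u])) => [[v u] _|u _] /=.
  by rewrite theadE; congr (_, _); apply: val_inj.
by rewrite [RHS]tuple_eta; apply: val_inj.
Qed.

Lemma sum_tuple_rev L (F : seq T -> V) :
  \sum_(u : L.-tuple T) F u = \sum_(u : L.-tuple T) F (rev u).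
Proof.
rewrite (reindex_inj (h := fun u : L.-tuple T => [tuple of rev u]))//.
by move=> u v [] /(can_inj revK) /val_inj.
Qed.

Lemma sum_tuple_rot L a (F : seq T -> V) :
  \sum_(u : L.-tuple T) F u = \sum_(u : L.-tuple T) F (rot a u).
Proof.
rewrite (reindex_inj (h := fun u : L.-tuple T => [tuple of rot a u]))//.
by move=> u v [] /rot_inj /val_inj.
Qed.

Lemma sum_tuple_rcons L (F : seq T -> V) :
  \sum_(u : L.+1.-tuple T) F u =
  \sum_(v : T) \sum_(u : L.-tuple T) F (rcons u v).
Proof.
rewrite sum_tuple_rev (sum_tupleS _ (F \o rev)); apply: eq_bigr => v _ /=.
rewrite (sum_tuple_rev _ (fun u => F (rcons u v))).
by apply: eq_bigr => u _; rewrite rev_cons.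
Qed.

End tuple_sums.

Section polya.
Context (R : realType) (n : nat).
Local Notation word := (seq 'I_n.+1).
Implicit Types (u w : word) (v : 'I_n.+1) (F : word -> R).

(* The probability that the first draws from the urn form the word w. *)
Definition polya w : R :=
  (\prod_v (count_mem v w)`!)%N%:R * n`!%:R / (n + size w)`!%:R.

Lemma polya_gt0 w : 0 < polya w.
Proof.
rewrite /polya !mulr_gt0 ?invr_gt0// ltr0n ?fact_gt0//.
by apply: prodn_gt0 => v; exact: fact_gt0.
Qed.

Lemma polya_ge0 w : 0 <= polya w. Proof. exact/ltW/polya_gt0. Qed.

Lemma polya_nil : polya [::] = 1.
Proof.
rewrite /polya big1//= addn0 mul1r divff// pnatr_eq0 -lt0n; exact: fact_gt0.
Qed.

(** The probability depends on the letter counts alone. A letter put in front thus has the same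
    conditional weight as one drawn last, and recursion on lists may peel off heads. *)
Lemma polya_cons v w :
  polya (v :: w) = polya w * ((count_mem v w).+1%:R / (n.+1 + size w)%:R).
Proof.
rewrite /polya (bigD1 v)//= [in RHS](bigD1 v)//= eqxx add1n factS.
rewrite [X in (_ * X)%N](eq_bigr (fun i => (count_mem i w)`!)); last first.
  by move=> i iv; rewrite [v == i]eq_sym (negbTE iv).
rewrite addnS factS addSn !natrM; field.
by rewrite -natrD nat1r !pnatr_eq0/= -lt0n fact_gt0.
Qed.

Lemma eq_polya w w' : perm_eq w w' -> polya w = polya w'.
Proof.
move=> ww'; rewrite /polya (perm_size ww'); congr (_%:R * _ / _).
by apply: eq_bigr => v _; move/permP : ww' => ->.
Qed.

Lemma polya_rcons v w :
  polya (rcons w v) = polya w * ((count_mem v w).+1%:R / (n.+1 + size w)%:R).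
Proof. by rewrite -polya_cons; apply: eq_polya; rewrite perm_rcons. Qed.

Definition polya_mean L F : R := \sum_(u : L.-tuple 'I_n.+1) polya u * F u.

Lemma eq_polya_mean L F G : (forall u, size u = L -> F u = G u) ->
  polya_mean L F = polya_mean L G.
Proof. by move=> FG; apply: eq_bigr => u _; rewrite FG ?size_tuple. Qed.

Lemma polya_mean_ge0 L F : (forall u, 0 <= F u) -> 0 <= polya_mean L F.
Proof. by move=> F0; apply: sumr_ge0 => u _; rewrite mulr_ge0 ?polya_ge0. Qed.

Lemma le_polya_mean L F G : (forall u, size u = L -> F u <= G u) ->
  polya_mean L F <= polya_mean L G.
Proof.
move=> FG; apply: ler_sum => u _.
by rewrite ler_wpM2l ?polya_ge0// FG ?size_tuple.
Qed.

Lemma polya_meanD L F G :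
  polya_mean L (fun u => F u + G u) = polya_mean L F + polya_mean L G.
Proof. by rewrite -big_split; apply: eq_bigr => u _; rewrite mulrDr. Qed.

Lemma polya_meanZ L k F : polya_mean L (fun u => k * F u) = k * polya_mean L F.
Proof. by rewrite /polya_mean mulr_sumr; apply: eq_bigr => u _; rewrite mulrCA. Qed.

Lemma polya_mean_sum (I : finType) L (F : I -> word -> R) :
  polya_mean L (fun u => \sum_i F i u) = \sum_i polya_mean L (F i).
Proof.
rewrite exchange_big; apply: eq_bigr => u _; exact: mulr_sumr.
Qed.

Lemma polya_mean0 F : polya_mean 0 F = F [::].
Proof.
by rewrite /polya_mean (sum_tuple0 (fun u => polya u * F u)) polya_nil mul1r.
Qed.

Lemma polya_mean_rot L a F : polya_mean L F = polya_mean L (F \o rot a).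
Proof.
rewrite /polya_mean (sum_tuple_rot _ a (fun u => polya u * F u)).
apply: eq_bigr => u _; congr (_ * _); apply: eq_polya.
by rewrite perm_rot.
Qed.

Lemma polya_meanS L F : polya_mean L.+1 F = polya_mean L (fun u =>
  (\sum_v (count_mem v u).+1%:R * F (v :: u)) / (n.+1 + L)%:R).
Proof.
rewrite /polya_mean (sum_tupleS _ (fun u => polya u * F u)) exchange_big.
apply: eq_bigr => u _; rewrite mulr_suml mulr_sumr; apply: eq_bigr => v _.
by rewrite polya_cons size_tuple; ring.
Qed.

Lemma polya_mean_rcons L F : polya_mean L.+1 F = polya_mean L (fun u =>
  (\sum_v (count_mem v u).+1%:R * F (rcons u v)) / (n.+1 + L)%:R).
Proof.
rewrite /polya_mean (sum_tuple_rcons _ (fun u => polya u * F u)) exchange_big.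
apply: eq_bigr => u _; rewrite mulr_suml mulr_sumr; apply: eq_bigr => v _.
by rewrite polya_rcons size_tuple; ring.
Qed.

Lemma sum_count_mem u : (\sum_v (count_mem v u).+1 = n.+1 + size u)%N.
Proof.
under eq_bigr do rewrite -addn1.
rewrite big_split/= sum1_card card_ord addnC; congr (_ + _)%N.
elim: u => [|a u IH]; first by rewrite big1.
rewrite /= big_split/= IH (bigD1 a)//= eqxx big1 => // i ia.
by rewrite eq_sym (negbTE ia).
Qed.

(** Consistency: the transition probabilities of the urn sum to one, so the last letters can be
    summed out one by one. *)
Lemma polya_mean_take L a F : (a <= L)%N ->
  polya_mean L (F \o take a) = polya_mean a F.
Proof.
move=> /subnK <-; elim: (L - a)%N => [|k IH].
  by apply: eq_polya_mean => u su; rewrite /= take_oversize// su.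
rewrite addSn polya_mean_rcons -IH; apply: eq_polya_mean => u su /=.
under eq_bigr.
  move=> v _; rewrite -cats1 takel_cat; last by rewrite su leq_addl.
  over.
rewrite -mulr_suml -natr_sum sum_count_mem su mulrAC divff ?mul1r//.
Qed.

Lemma polya_mean_cst L a : polya_mean L (fun=> a) = a.
Proof.
have := polya_mean_take (fun=> a) (leq0n L).
by rewrite polya_mean0.
Qed.

Lemma polya_step v u (g : bool -> R) :
  \sum_x (count_mem x u).+1%:R * g (x == v) =
  (count_mem v u).+1%:R * g true +
  ((n.+1 + size u)%:R - (count_mem v u).+1%:R) * g false.
Proof.
rewrite (bigD1 v)//= eqxx; congr (_ + _).
rewrite -sum_count_mem natr_sum [in RHS](bigD1 v)//= addrAC subrr add0r mulr_suml.
by apply: eq_bigr => x /negbTE ->.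
Qed.

Definition rising k (y : nat) : R := \prod_(j < k) (y + j)%:R.

Lemma rising_step k y : y%:R * rising k y.+1 = rising k y * (y + k)%:R.
Proof.
rewrite /rising -(big_ord_recr k (fun j => (y + j)%:R)) big_ord_recl addn0.
by congr (_ * _); apply: eq_bigr => i _; rewrite addSnnS.
Qed.

Lemma rising_gt0 k y : (0 < y)%N -> 0 < rising k y.
Proof. by move=> y0; apply: prodr_gt0 => j _; rewrite ltr0n addn_gt0 y0. Qed.

(** A rising factorial of the number of balls of [v] is multiplied on average by a factor that does
    not depend on that number. Divided by the same rising factorial of the total number of balls, it
    is a martingale. *)
Lemma polya_step_rising k v u :
  (\sum_x (count_mem x u).+1%:R * rising k (count_mem v (x :: u)).+1) /
    (n.+1 + size u)%:R =
  rising k (count_mem v u).+1 * ((n.+1 + size u + k)%:R / (n.+1 + size u)%:R).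
Proof.
rewrite /= (polya_step v u (fun b => rising k (b + count_mem v u).+1)) /=.
rewrite add0n add1n rising_step; set N := (n.+1 + _)%N; set y := (count_mem _ _).+1.
have N0 : N%:R != 0 :> R by rewrite pnatr_eq0 /N addSn.
rewrite [in LHS]natrD [X in _ = _ * (X / _)]natrD.
by move: N0; set M : R := N%:R => N0; field.
Qed.

Lemma polya_mean_rising L k v :
  polya_mean L (fun u => rising k (count_mem v u).+1) =
  rising k 1 * (rising k (n.+1 + L) / rising k n.+1).
Proof.
elim: L => [|L IH].
  by rewrite polya_mean0 /= addn0 divff ?mulr1// gt_eqF// rising_gt0.
rewrite polya_meanS; transitivity (polya_mean L (fun u =>
    ((n.+1 + L + k)%:R / (n.+1 + L)%:R) * rising k (count_mem v u).+1)).
  by apply: eq_polya_mean => u <-; rewrite polya_step_rising mulrC.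
rewrite polya_meanZ IH addnS.
have N0 : (n.+1 + L)%:R != 0 :> R by rewrite pnatr_eq0 addSn.
have -> : rising k (n.+1 + L).+1 =
    rising k (n.+1 + L) * (n.+1 + L + k)%:R / (n.+1 + L)%:R.
  by rewrite -rising_step mulrAC divff// mul1r.
by ring.
Qed.

(** The sixth power is at most [rising 6] of the count plus one, whose mean is 6! = 720 times six
    ratios, each at most [1 + L / (n + 1)]. *)
Lemma polya_mean_count6 L v :
  polya_mean L (fun u => (count_mem v u)%:R ^+ 6) <=
  720 * (1 + L%:R / n.+1%:R) ^+ 6.
Proof.
have pc (x : R) : x ^+ 6 = \prod_(j < 6) x by rewrite prodr_const card_ord.
apply: (@le_trans _ _ (polya_mean L (fun u => rising 6 (count_mem v u).+1))).
  apply: le_polya_mean => u _; rewrite /rising pc; apply: ler_prod => j _.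
  by rewrite ler0n/= ler_nat addSn ltnW// ltnS leq_addr.
rewrite polya_mean_rising.
have -> : rising 6 1 = 720 :> R.
  by rewrite /rising -natr_prod !big_ord_recr big_ord0.
rewrite ler_pM2l ?ltr0n//; rewrite /rising -prodf_div pc.
apply: ler_prod => j _; rewrite divr_ge0//=.
have n0 : 0 < n.+1%:R :> R by [].
rewrite ler_pdivrMr; last by rewrite ltr0n addSn.
have -> : (n.+1 + L + j)%:R = (n.+1 + j)%:R + L%:R :> R by rewrite -natrD addnAC.
rewrite mulrDl mul1r lerD2l natrD mulrDr divfK ?gt_eqF// lerDl.
by rewrite mulr_ge0// divr_ge0.
Qed.

(** The word is cut into consecutive disjoint pairs, each standing for an edge; a single last letter
    is ignored. *)
Fixpoint loop_count v u : nat :=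
  if u is a :: b :: u' then ((a == v) && (b == v)) + loop_count v u' else 0.

Definition pair_step u (F : 'I_n.+1 -> 'I_n.+1 -> R) : R :=
  (\sum_b (count_mem b u).+1%:R *
     ((\sum_a (count_mem a (b :: u)).+1%:R * F a b) / (n.+1 + (size u).+1)%:R)) /
  (n.+1 + size u)%:R.

Lemma polya_meanSS L F : polya_mean L.+2 F =
  polya_mean L (fun u => pair_step u (fun a b => F [:: a, b & u])).
Proof.
rewrite !polya_meanS; apply: eq_polya_mean => u <-.
by rewrite /pair_step.
Qed.

Lemma eq_pair_step u (F G : 'I_n.+1 -> 'I_n.+1 -> R) : (forall a b, F a b = G a b) ->
  pair_step u F = pair_step u G.
Proof.
move=> FG; congr (_ / _); apply: eq_bigr => b _; congr (_ * (_ / _)).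
by apply: eq_bigr => a _; rewrite FG.
Qed.

Lemma pair_stepD u (F G : 'I_n.+1 -> 'I_n.+1 -> R) :
  pair_step u (fun a b => F a b + G a b) = pair_step u F + pair_step u G.
Proof.
rewrite /pair_step -mulrDl -big_split/=; congr (_ / _).
apply: eq_bigr => b _; rewrite -mulrDr -mulrDl -big_split/=; congr (_ * (_ / _)).
by apply: eq_bigr => a _; rewrite mulrDr.
Qed.

Lemma pair_stepZ u k (F : 'I_n.+1 -> 'I_n.+1 -> R) :
  pair_step u (fun a b => k * F a b) = k * pair_step u F.
Proof.
rewrite /pair_step mulrA mulr_sumr; congr (_ / _).
apply: eq_bigr => b _; rewrite [RHS]mulrCA [k * _]mulrA mulr_sumr; congr (_ * (_ / _)).
by apply: eq_bigr => a _; rewrite mulrCA.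
Qed.

Lemma pair_step_rising k v u :
  pair_step u (fun a b => rising k (count_mem v [:: a, b & u]).+1) =
  rising k (count_mem v u).+1 *
    (rising 2 (n.+1 + size u + k) / rising 2 (n.+1 + size u)).
Proof.
rewrite /pair_step (eq_bigr (fun b => (count_mem b u).+1%:R *
    rising k (count_mem v (b :: u)).+1 *
    ((n.+1 + (size u).+1 + k)%:R / (n.+1 + (size u).+1)%:R))); last first.
  by move=> b _; rewrite (polya_step_rising k v (b :: u)) mulrA.
rewrite -mulr_suml mulrAC polya_step_rising.
have r2 y : rising 2 y = y%:R * y.+1%:R.
  by rewrite /rising !big_ord_recr big_ord0/= mul1r addn0 addn1.
by rewrite !r2 addnS addSn invfM; ring.
Qed.

Lemma pair_step_cst u g : pair_step u (fun _ _ => g) = g.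
Proof.
have := pair_step_rising 0 ord0 u; rewrite /rising !big_ord0 addn0 mul1r divff.
  move=> h; rewrite -[in RHS](mulr1 g) -h -pair_stepZ.
  by apply: eq_pair_step => a b; rewrite big_ord0 mulr1.
by rewrite gt_eqF// (@rising_gt0 2).
Qed.

Lemma pair_step_loop v u g :
  pair_step u (fun a b => ((a == v) && (b == v))%:R * g) =
  rising 2 (count_mem v u).+1 * g / rising 2 (n.+1 + size u).
Proof.
rewrite /pair_step (bigD1 v)//= [X in _ + X]big1 ?addr0; last first.
  move=> b bv; rewrite big1 ?mul0r ?mulr0// => a _.
  by rewrite (negbTE bv) andbF mul0r mulr0.
rewrite (bigD1 v)//= [X in _ + X]big1 ?addr0; last first.
  by move=> a av; rewrite (negbTE av) mul0r mulr0.
rewrite eqxx mul1r /rising !big_ord_recr !big_ord0/= !mul1r !addn0 !addn1 add1n addnS.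
by rewrite invfM; ring.
Qed.

Lemma rising_add j k y : rising (j + k) y = rising j y * rising k (y + j).
Proof.
rewrite /rising big_split_ord/=; congr (_ * _); apply: eq_bigr => i _.
by rewrite addnA.
Qed.

(** The mixed moment required by the recursion for second moments. A new loop at [v] has probability
    [rising 2 y / rising 2 N] and raises [y] by 2, so its contribution is a multiple of [rising 4 y]
    and the recursion closes. *)
Lemma polya_mean_loop_rising m v :
  polya_mean m.*2 (fun u => (loop_count v u)%:R * rising 2 (count_mem v u).+1) =
  24 * m%:R * rising 2 (n.+1 + m.*2) / rising 4 n.+1.
Proof.
elim: m => [|m IH]; first by rewrite polya_mean0 !(mul0r, mulr0).
rewrite doubleS polya_meanSS; set N := (n.+1 + m.*2)%N.
have N0 : rising 2 N != 0 by rewrite gt_eqF// rising_gt0// /N addSn.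
have n0 : rising 4 n.+1 != 0 by rewrite gt_eqF// rising_gt0.
transitivity (polya_mean m.*2 (fun u =>
    (rising 2 (N + 2) / rising 2 N) *
      ((loop_count v u)%:R * rising 2 (count_mem v u).+1) +
    (rising 2 N)^-1 * rising 4 (count_mem v u).+1)).
  apply: eq_polya_mean => u su.
  rewrite (@eq_pair_step _ _ (fun a b => (loop_count v u)%:R *
      rising 2 (count_mem v [:: a, b & u]).+1 +
      ((a == v) && (b == v))%:R * rising 2 (count_mem v u).+3)); last first.
    move=> a b /=; rewrite natrD mulrDl addrC; congr (_ + _).
    by case: (a == v); case: (b == v); rewrite ?mul0r// !add1n.
  rewrite pair_stepD pair_stepZ pair_step_rising pair_step_loop su -/N.
  by rewrite (rising_add 2 2 (count_mem v u).+1) -[(count_mem v u).+3]addn2; ring.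
rewrite polya_meanD !polya_meanZ IH polya_mean_rising -/N.
rewrite (rising_add 2 2 N) -[m.*2.+2]addn2 addnA -/N.
have -> : rising 4 1 = 24 :> R by rewrite /rising -natr_prod !big_ord_recr big_ord0.
rewrite -natr1; field.
by rewrite N0 n0.
Qed.

(** The two terms count ordered couples of distinct pairs and single pairs: a given pair is a loop
    at [v] with probability [2 / rising 2 n.+1], and two given pairs both are with probability
    [24 / rising 4 n.+1]. The induction adds [1 + 2 Z] to [Z ^ 2] whenever a new loop appears. *)
Lemma polya_mean_loop_sqr m v :
  polya_mean m.*2 (fun u => (loop_count v u)%:R ^+ 2) =
  24 * m%:R * (m%:R - 1) / rising 4 n.+1 + 2 * m%:R / rising 2 n.+1.
Proof.
have n2 : rising 2 n.+1 != 0 by rewrite gt_eqF// rising_gt0.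
have n4 : rising 4 n.+1 != 0 by rewrite gt_eqF// rising_gt0.
elim: m => [|m IH]; first by rewrite polya_mean0 /= !(mulr0, mul0r) addr0 expr0n.
rewrite doubleS polya_meanSS; set N := (n.+1 + m.*2)%N.
have N0 : rising 2 N != 0 by rewrite gt_eqF// rising_gt0// /N addSn.
transitivity (polya_mean m.*2 (fun u => (loop_count v u)%:R ^+ 2 +
    ((rising 2 N)^-1 * rising 2 (count_mem v u).+1 +
    (2 / rising 2 N) * ((loop_count v u)%:R * rising 2 (count_mem v u).+1)))).
  apply: eq_polya_mean => u su.
  rewrite (@eq_pair_step _ _ (fun a b => (loop_count v u)%:R ^+ 2 +
      ((a == v) && (b == v))%:R * (1 + 2 * (loop_count v u)%:R))); last first.
    by move=> a b /=; rewrite natrD; case: (_ && _) => /=; ring.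
  rewrite pair_stepD pair_step_cst pair_step_loop su -/N; ring.
rewrite !polya_meanD !polya_meanZ IH polya_mean_loop_rising polya_mean_rising -/N.
have -> : rising 2 1 = 2 :> R by rewrite /rising -natr_prod !big_ord_recr big_ord0.
rewrite -natr1; field.
by rewrite N0 n2 n4.
Qed.

End polya.

(** * The jumble distance and the row sums *)

Section jumble_bound.
Context (R : realType).

(** The sum over [S] and [T] is at most [#|S| * B] by rows and, by symmetry of the matrices, at most
    [#|T| * B] by columns. It is therefore at most their geometric mean, which cancels the
    normalization. *)
Lemma jumble_dist_le n (G H : multigraph n) (B : R) : 0 <= B ->
  (forall i, \sum_j `|(G i j)%:R - (H i j)%:R| <= B) ->
  jumble_dist R G H <= n%:R^-1 * B.
Proof.
move=> B0 rowB.
have sym (K : multigraph n) i j : K i j = K j i.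
  by case: K => K /= /eqP/matrixP/(_ i j); rewrite mxE.
apply: ler_wpM2l; first by rewrite invr_ge0.
apply: bigmax_le => // S S0; apply: bigmax_le => // T T0.
have cardD (A : {set 'I_n}) : A != finset.set0 -> 0 < #|A|%:R :> R.
  by move=> A0; rewrite ltr0n card_gt0.
rewrite [leLHS]mulrC ler_pdivrMr; last by rewrite sqrtr_gt0 mulr_gt0 ?cardD.
set d := fun i j => (G i j)%:R - (H i j)%:R : R.
have bound (A C : {set 'I_n}) (f : 'I_n -> 'I_n -> R) :
    (forall i, \sum_j `|f i j| <= B) ->
    `|\sum_(i in A) \sum_(j in C) f i j| <= #|A|%:R * B.
  move=> fB; apply: (le_trans (ler_norm_sum _ _ _)).
  rewrite mulr_natl -sumr_const; apply: ler_sum => i _.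
  apply: (le_trans (ler_norm_sum _ _ _)); apply: le_trans (fB i).
  rewrite [leRHS](bigID (fun j => j \in C))/= lerDl.
  by apply: sumr_ge0.
have XS := bound S T d rowB.
have XT : `|\sum_(i in S) \sum_(j in T) d i j| <= #|T|%:R * B.
  rewrite exchange_big/=; apply: (bound T S (fun j i => d i j)) => i.
  by under eq_bigr do rewrite /d sym [X in _ - X%:R]sym; exact: rowB.
set X := `|_|; rewrite -/X in XS XT *.
have -> : X = Num.sqrt (X ^+ 2) by rewrite sqrtr_sqr normr_id.
rewrite [leRHS]mulrC -{1}(ger0_norm B0) -sqrtr_sqr -sqrtrM ?sqr_ge0//.
apply: ler_wsqrtr.
have -> : #|S|%:R * #|T|%:R * B ^+ 2 = (#|S|%:R * B) * (#|T|%:R * B) by ring.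
by rewrite expr2 ler_pM// normr_ge0.
Qed.

End jumble_bound.

Section word_edges.
Context (n : nat).
Local Notation word := (seq 'I_n.+1).
Implicit Types (u : word) (v i j : 'I_n.+1) (k m : nat).

Lemma sum_count_pairs k u v : (k.*2 <= size u)%N ->
  (\sum_(t < k) ((nth ord0 u t.*2 == v) + (nth ord0 u t.*2.+1 == v)) =
   count_mem v (take k.*2 u))%N.
Proof.
elim: k u => [|k IH] [|a [|b u]]//=; rewrite ?big_ord0 ?take0//.
by rewrite doubleS !ltnS => ku; rewrite big_ord_recl /= -addnA -IH.
Qed.

Lemma sum_loop_count k u v : (k.*2 <= size u)%N ->
  (\sum_(t < k) ((nth ord0 u t.*2 == v) && (nth ord0 u t.*2.+1 == v)) =
   loop_count v (take k.*2 u))%N.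
Proof.
elim: k u => [|k IH] [|a [|b u]]//=; rewrite ?big_ord0 ?take0//.
by rewrite doubleS !ltnS => ku; rewrite big_ord_recl /= -IH.
Qed.

Lemma pag_mult_double m (w : nat -> 'I_n.+1) i j :
  pag_mult m.*2 w i j = (\sum_(k < m) is_edge (w k.*2) (w k.*2.+1) i j)%N.
Proof. by rewrite /pag_mult doubleK. Qed.

Lemma sum_is_edge_le a b i :
  (\sum_(j | j != i) is_edge a b i j <= (a == i) + (b == i))%N.
Proof.
rewrite /is_edge [a == i]eq_sym [b == i]eq_sym.
have sum1 c : (\sum_(j | j != i) (j == c) <= 1)%N.
  apply: (@leq_trans (\sum_j (j == c))).
    by rewrite [leqRHS](bigID (fun j => j != i))/= leq_addr.
  by rewrite (bigD1 c)//= eqxx big1 // => j /negbTE ->.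
case: (i == a); case: (i == b) => /=.
- apply: (@leq_trans (\sum_(j | j != i) ((j == b) + (j == a)))).
    by apply: leq_sum => j _; case: (j == b); case: (j == a).
  by rewrite big_split leq_add.
- by under eq_bigr do rewrite orbF; exact: sum1.
- exact: sum1.
- by rewrite big1.
Qed.

(** [w_multigraph] reads only the entries above the diagonal, so the loops of the word are discarded
    here. *)
Definition word_w_multigraph u : multigraph n.+1 :=
  w_multigraph (fun i j => pag_mult (size u) (nth ord0 u) i j).

Lemma word_w_multigraph_take m u i j : (m.*2 <= size u)%N ->
  word_w_multigraph (take m.*2 u) i j =
  if i == j then 0%N else pag_mult m.*2 (nth ord0 u) i j.
Proof.
move=> mu; rewrite mxE /w_mult size_takel//.
have E a b : pag_mult m.*2 (nth ord0 (take m.*2 u)) a b =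
    pag_mult m.*2 (nth ord0 u) a b.
  rewrite !pag_mult_double; apply: eq_bigr => k _.
  by rewrite !nth_take// ?ltn_Sdouble ?ltn_double.
rewrite !E -val_eqE/=; case: ltngtP => // _; exact: pag_multC.
Qed.

(** Both graphs are made of initial segments of one sequence of edges. Off the diagonal all
    differences thus have the same sign, and they count the edges of the window between the two
    lengths. On the diagonal only the urn graph has anything. *)
Lemma row_dist_le (R : realType) N m u i : (N <= size u)%N -> (m.*2 <= size u)%N ->
  \sum_j `|(pag_multigraph N (nth ord0 u) i j)%:R -
           (word_w_multigraph (take m.*2 u) i j)%:R| <=
  (count_mem i (take ((maxn N./2 m).*2 - (minn N./2 m).*2)
    (drop (minn N./2 m).*2 u)))%:R +
  (loop_count i (take N./2.*2 u))%:R :> R.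
Proof.
move=> Nu mu; set hi := maxn _ _; set lo := minn _ _; set M := N./2.
have Mu : (M.*2 <= size u)%N.
  by apply: leq_trans Nu; rewrite -[leqRHS]odd_double_half leq_addl.
pose e t j := nat_of_bool (is_edge (nth ord0 u t.*2) (nth ord0 u t.*2.+1) i j).
have diag : pag_multigraph N (nth ord0 u) i i = loop_count i (take M.*2 u).
  rewrite mxE /pag_mult -sum_loop_count//; apply: eq_bigr => t _.
  by rewrite /is_edge andbC orbb andbC ![i == _]eq_sym.
have lohi : (lo <= hi)%N by rewrite geq_min leq_max leqnn.
have offd j : j != i ->
    `|(pag_multigraph N (nth ord0 u) i j)%:R -
           (word_w_multigraph (take m.*2 u) i j)%:R| =
    (\sum_(lo <= t < hi) e t j)%N%:R :> R.
  move=> ji; rewrite word_w_multigraph_take// eq_sym (negbTE ji) pag_mult_double.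
  rewrite mxE /pag_mult -/M -!(big_mkord xpredT (e^~ j)).
  rewrite /lo /hi -/M; case: (leqP M m) => Mm.
    rewrite distrC (big_cat_nat (leq0n M) Mm)/= natrD addrC addKr.
    by rewrite ger0_norm.
  rewrite (big_cat_nat (leq0n m) (ltnW Mm))/= natrD addrC addKr.
  by rewrite ger0_norm.
rewrite (bigD1 i)//= diag word_w_multigraph_take// eqxx subr0 ger0_norm//.
rewrite addrC lerD2r (eq_bigr _ offd) -natr_sum ler_nat exchange_big/=.
have hu : (hi.*2 <= size u)%N by rewrite /hi; case: (leqP N./2 m).
rewrite -doubleB -sum_count_pairs; last first.
  by rewrite size_drop doubleB leq_sub2r.
rewrite -{1}[lo]add0n -{1}(subnK lohi) big_addn addnK big_mkord.
apply: leq_sum => t _; rewrite !nth_drop addnS -doubleD addnC.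
exact: sum_is_edge_le.
Qed.

End word_edges.

(** * Poisson splitting *)

Section exponential_series.
Local Open Scope ereal_scope.
Context (R : realType).
Implicit Types x : R.

Lemma nneseries_recl0 (f : nat -> \bar R) : (forall m, 0 <= f m) ->
  \sum_(m <oo) f m = f 0%N + \sum_(m <oo) f m.+1.
Proof.
move=> f0; rewrite nneseries_recl//; congr (_ + _).
by under [RHS]eq_eseriesr do rewrite -addn1; rewrite nneseries_addn.
Qed.

Lemma nneseries_expR x : (0 <= x)%R ->
  \sum_(m <oo) (x ^+ m / m`!%:R)%:E = (expR x)%:E.
Proof.
move=> x0; rewrite expRE -EFin_lim; last first.
  rewrite /pseries/=; under eq_fun do rewrite mulrC.
  exact: is_cvg_series_exp_coeff.
apply/congr_lim/funext => m/=; rewrite /pseries/= /series/= -sumEFin//.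
by under eq_bigr do rewrite mulrC.
Qed.

(** Unlike [poisson_pmf], this has no case distinction on the sign of the rate, so the moment
    identities also hold at rate 0. *)
Definition poisson_mass (m : nat) x : R := (x ^+ m / m`!%:R * expR (- x))%R.

Lemma poisson_mass_ge0 m x : (0 <= x)%R -> (0 <= poisson_mass m x)%R.
Proof. by move=> x0; rewrite mulr_ge0 ?expR_ge0// divr_ge0// exprn_ge0. Qed.

Lemma poisson_massS m x : (m.+1%:R * poisson_mass m.+1 x = x * poisson_mass m x)%R.
Proof.
rewrite /poisson_mass exprS factS natrM; field.
by rewrite nat1r !pnatr_eq0 -lt0n fact_gt0.
Qed.

Lemma sum_poisson_mass x : (0 <= x)%R -> \sum_(m <oo) (poisson_mass m x)%:E = 1.
Proof.
move=> x0; rewrite /poisson_mass.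
under eq_eseriesr do rewrite mulrC EFinM.
rewrite nneseriesZl; last by move=> m _; rewrite lee_fin divr_ge0// exprn_ge0.
by rewrite nneseries_expR// -EFinM expRN mulVf// gt_eqF ?expR_gt0.
Qed.

Lemma sum_poisson_mass1 x : (0 <= x)%R ->
  \sum_(m <oo) (poisson_mass m x * m%:R)%:E = x%:E.
Proof.
move=> x0; rewrite nneseries_recl0; last first.
  by move=> m; rewrite lee_fin mulr_ge0 ?poisson_mass_ge0.
under eq_eseriesr do rewrite mulrC poisson_massS EFinM.
rewrite nneseriesZl; last by move=> m _; rewrite lee_fin poisson_mass_ge0.
by rewrite mulr0 add0e sum_poisson_mass// mule1.
Qed.

Lemma sum_poisson_mass2 x : (0 <= x)%R ->
  \sum_(m <oo) (poisson_mass m x * (m%:R * m.-1%:R))%:E = (x ^+ 2)%:E.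
Proof.
move=> x0; rewrite nneseries_recl0; last first.
  by move=> m; rewrite lee_fin mulr_ge0 ?poisson_mass_ge0// mulr_ge0.
under eq_eseriesr do
  rewrite mulrA [(poisson_mass _ _ * _)%R]mulrC poisson_massS -mulrA EFinM.
rewrite nneseriesZl; last by move=> m _; rewrite lee_fin mulr_ge0 ?poisson_mass_ge0.
by rewrite mul0r mulr0 add0e sum_poisson_mass1// -EFinM.
Qed.

End exponential_series.

Section poisson_splitting.
Context (R : realType) (n : nat).
Local Notation word := (seq 'I_n.+1).
Implicit Types (u : word) (i j a b : 'I_n.+1) (k : 'I_n.+1 -> 'I_n.+1 -> nat).
Variable x : 'I_n.+1 -> R.

Definition weight u : R := \prod_(v <- u) x v.

Lemma sum_weight L : \sum_(u : L.-tuple 'I_n.+1) weight u = (\sum_i x i) ^+ L.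
Proof.
elim: L => [|L IH]; first by rewrite (sum_tuple0 weight) /weight big_nil.
rewrite (sum_tupleS _ weight) exprS -IH mulr_suml.
apply: eq_bigr => i _; rewrite mulr_sumr; apply: eq_bigr => u _.
by rewrite /weight big_cons.
Qed.

Definition edge_count u i j : nat := pag_mult (size u) (nth ord0 u) i j.

Lemma edge_count_cons a b u i j :
  edge_count [:: a, b & u] i j = (is_edge a b i j + edge_count u i j)%N.
Proof. by rewrite /edge_count /pag_mult /= big_ord_recl. Qed.

Definition has_edge_counts k u : bool :=
  [forall i : 'I_n.+1, forall j : 'I_n.+1, (i < j)%N ==> (edge_count u i j == k i j)].

Lemma has_edge_countsP k u :
  reflect (forall i j, (i < j)%N -> edge_count u i j = k i j) (has_edge_counts k u).
Proof.
apply: (iffP forallP) => [H i j ij|H i].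
  by have /forallP/(_ j) := H i; rewrite ij => /eqP.
by apply/forallP => j; apply/implyP => ij; rewrite H.
Qed.

Definition remove_edge k a b i j : nat := (k i j - ((i == a) && (j == b)))%N.

Lemma has_edge_counts_loop k a u :
  has_edge_counts k [:: a, a & u] = has_edge_counts k u.
Proof.
apply/has_edge_countsP/has_edge_countsP => H i j ij; rewrite -(H i j ij);
  rewrite edge_count_cons /is_edge orbb (_ : _ && _ = false)//;
  by apply/negbTE/negP => /andP[/eqP ia /eqP ja]; rewrite ia ja ltnn in ij.
Qed.

Lemma has_edge_counts_edge k a b u : (a < b)%N ->
  has_edge_counts k [:: a, b & u] =
  (0 < k a b)%N && has_edge_counts (remove_edge k a b) u.
Proof.
move=> ab.
have E i j : (i < j)%N -> is_edge a b i j = (i == a) && (j == b).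
  move=> ij; rewrite /is_edge; case: (i =P b) => [ib|]; last by rewrite orbF.
  case: (j =P a) => [ja|]; last by rewrite orbF.
  by move: ij; rewrite ib ja ltnNge ltnW.
apply/has_edge_countsP/andP => [H|[k0 /has_edge_countsP H] i j ij].
  have Hab := H _ _ ab; rewrite edge_count_cons E// !eqxx add1n in Hab.
  split; first by rewrite -Hab.
  apply/has_edge_countsP => i j ij.
  by rewrite /remove_edge -H// edge_count_cons E// addKn.
rewrite edge_count_cons E// H// /remove_edge subnKC//.
by case: (i =P a) => [->|//]; case: (j =P b) => [->|].
Qed.

Lemma has_edge_countsC k a b u :
  has_edge_counts k [:: a, b & u] = has_edge_counts k [:: b, a & u].
Proof.
by apply/has_edge_countsP/has_edge_countsP => H i j ij;
  rewrite -(H i j ij) !edge_count_cons /is_edge orbC.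
Qed.

Lemma sum_pairs (f : 'I_n.+1 -> 'I_n.+1 -> R) :
  \sum_a \sum_b f a b =
  \sum_a f a a + \sum_(a < n.+1) \sum_(b < n.+1 | (a < b)%N) (f a b + f b a).
Proof.
have -> : \sum_(a < n.+1) \sum_(b < n.+1 | (a < b)%N) (f a b + f b a) =
    \sum_(a < n.+1) (\sum_(b < n.+1 | (a < b)%N) f a b +
                     \sum_(b < n.+1 | (b < a)%N) f a b).
  under eq_bigr do rewrite big_split; rewrite !big_split; congr (_ + _).
  by rewrite (exchange_big_dep predT).
rewrite -big_split; apply: eq_bigr => a _ /=.
rewrite (bigD1 a)//=; congr (_ + _).
rewrite (bigID (fun b : 'I_n.+1 => (a < b)%N))/=; congr (_ + _); apply: eq_bigl => b.
  by rewrite -val_eqE/=; case: ltngtP.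
by rewrite -val_eqE/=; case: ltngtP.
Qed.

Definition num_edges k : nat := (\sum_(i < n.+1) \sum_(j < n.+1 | (i < j)%N) k i j)%N.

(** The factor 2 stands for the two orders in which a pair of letters gives the same edge. *)
Definition edge_mass k : R :=
  \prod_(i < n.+1) \prod_(j < n.+1 | (i < j)%N)
    ((2 * x i * x j) ^+ k i j / (k i j)`!%:R).

(* 1 / (m - s)! is read as 0 for m < s. *)
Definition loop_mass (m s : nat) : R :=
  if (s <= m)%N then (\sum_i x i ^+ 2) ^+ (m - s) / (m - s)`!%:R else 0.

Lemma loop_massSS m s : loop_mass m.+1 s.+1 = loop_mass m s.
Proof. by rewrite /loop_mass ltnS subSS. Qed.

(** The convention for [m < s] is consistent with this recursion: at [s = m + 1] the left side is 0
    and so is the factor [m + 1 - s], and beyond that both masses are 0. *)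
Lemma loop_massS m s : (\sum_i x i ^+ 2) * loop_mass m s =
  (m.+1%:R - s%:R) * loop_mass m.+1 s.
Proof.
rewrite /loop_mass; case: (leqP s m) => sm.
  rewrite (leq_trans sm)// -natrB; last exact: leq_trans sm _.
  rewrite subSn// exprS factS natrM; field.
  by rewrite nat1r !pnatr_eq0 -lt0n fact_gt0.
have [->|sm1] := eqVneq s m.+1; first by rewrite leqnn subrr mulr0 mul0r.
by rewrite leqNgt ltn_neqAle eq_sym sm1 sm/= !mulr0.
Qed.

Lemma remove_edgeE k a b i j : (i, j) != (a, b) -> remove_edge k a b i j = k i j.
Proof.
by rewrite /remove_edge xpair_eqE; case: (_ && _) => // _; rewrite subn0.
Qed.

Lemma num_edges_remove k a b : (a < b)%N -> (0 < k a b)%N ->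
  num_edges k = (num_edges (remove_edge k a b)).+1.
Proof.
move=> ab k0; rewrite /num_edges (bigD1 a)//= [in RHS](bigD1 a)//=.
rewrite (bigD1 b)//= [in RHS](bigD1 b)//= {1}/remove_edge !eqxx subn1.
rewrite -[in LHS](prednK k0) !addSn; congr (_ + _ + _).+1.
  apply: eq_bigr => j /andP[_ jb]; rewrite remove_edgeE//.
  by rewrite xpair_eqE (negbTE jb) andbF.
apply: eq_bigr => i ia; apply: eq_bigr => j _; rewrite remove_edgeE//.
by rewrite xpair_eqE (negbTE ia).
Qed.

Lemma edge_mass_remove k a b : (a < b)%N -> (0 < k a b)%N ->
  2 * x a * x b * edge_mass (remove_edge k a b) = (k a b)%:R * edge_mass k.
Proof.
move=> ab k0; rewrite /edge_mass (bigD1 a)//= [in RHS](bigD1 a)//=.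
rewrite (bigD1 b)//= [in RHS](bigD1 b)//= {1 2}/remove_edge !eqxx subn1.
set p1 := \prod_(j | _) _; set p2 := \prod_(i | _) _.
set p3 := \prod_(j | _) _; set p4 := \prod_(i | _) _.
have -> : p1 = p3.
  apply: eq_bigr => j /andP[_ jb]; rewrite remove_edgeE//.
  by rewrite xpair_eqE (negbTE jb) andbF.
have -> : p2 = p4.
  apply: eq_bigr => i ia; apply: eq_bigr => j _; rewrite remove_edgeE//.
  by rewrite xpair_eqE (negbTE ia).
case: (k a b) k0 => // y _ /=; rewrite exprS factS natrM; field.
by rewrite nat1r !pnatr_eq0 -lt0n fact_gt0.
Qed.

(* By induction on m, conditioning on the first pair of the word. *)
Lemma sum_weight_edge_counts m k :
  \sum_(u : m.*2.-tuple 'I_n.+1 | has_edge_counts k u) weight u =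
  m`!%:R * (edge_mass k * loop_mass m (num_edges k)).
Proof.
rewrite big_mkcond; elim: m k => [|m IH] k.
  rewrite (sum_tuple0 (fun u => if has_edge_counts k u then weight u else 0)).
  rewrite /weight big_nil fact0 mul1r /loop_mass leqn0.
  have ec0 i j : edge_count [::] i j = 0%N by rewrite /edge_count /pag_mult big_ord0.
  have [/eqP s0|s0] := ifPn (num_edges k == 0%N).
    have k0 i j : (i < j)%N -> k i j = 0%N.
      move=> ij; apply/eqP; rewrite -leqn0 -s0 /num_edges (bigD1 i)//= (bigD1 j)//=.
      by rewrite -addnA leq_addr.
    rewrite (introT (has_edge_countsP _ _)) => [|i j ij]; last by rewrite ec0 k0.
    rewrite s0 subnn expr0 fact0 divr1 mulr1 /edge_mass big1// => i _.
    by rewrite big1// => j ij; rewrite k0// expr0 fact0 divr1.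
  rewrite mulr0 ifF//; apply/negbTE; apply: contra s0 => /has_edge_countsP H.
  by rewrite /num_edges big1// => i _; rewrite big1// => j ij; rewrite -H.
pose W k u := if has_edge_counts k u then weight u else 0.
rewrite doubleS (sum_tupleS _ (W k)).
under eq_bigr do rewrite (sum_tupleS _ (fun u => W k (_ :: u))).
rewrite sum_pairs.
have W_loop a u : W k [:: a, a & u] = x a ^+ 2 * W k u.
  rewrite /W has_edge_counts_loop; case: ifPn; rewrite ?mulr0// /weight !big_cons.
  by rewrite mulrA expr2.
(* The two orders of the letters weigh the same, which gives the factor 2 of the rate; putting the
   removed edge back then brings out the multiplicity [k a b]. *)
have W_edge a b : (a < b)%N ->
    \sum_(u : m.*2.-tuple 'I_n.+1) W k [:: a, b & u] +
    \sum_(u : m.*2.-tuple 'I_n.+1) W k [:: b, a & u] =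
    (k a b)%:R * (m`!%:R * (edge_mass k * loop_mass m.+1 (num_edges k))).
  move=> ab.
  have -> : \sum_(u : m.*2.-tuple 'I_n.+1) W k [:: b, a & u] =
      \sum_(u : m.*2.-tuple 'I_n.+1) W k [:: a, b & u].
    apply: eq_bigr => u _; rewrite /W has_edge_countsC /weight !big_cons.
    by case: ifPn => // _; ring.
  have [k0|k0] := posnP (k a b).
    rewrite k0 mul0r big1 ?addr0// => u _.
    by rewrite /W has_edge_counts_edge// k0.
  rewrite (num_edges_remove ab k0) loop_massSS.
  transitivity (2 * x a * x b *
      \sum_(u : m.*2.-tuple 'I_n.+1) W (remove_edge k a b) u).
    rewrite -mulr2n -[LHS]mulr_natl !mulr_sumr; apply: eq_bigr => u _.
    rewrite /W has_edge_counts_edge// k0/=; case: ifPn; rewrite ?mulr0//.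
    by rewrite /weight !big_cons !mulrA.
  rewrite IH; transitivity (m`!%:R * (2 * x a * x b *
      edge_mass (remove_edge k a b) * loop_mass m (num_edges (remove_edge k a b)))).
    by ring.
  by rewrite edge_mass_remove//; ring.
under [X in _ + X]eq_bigr => a _ do rewrite (eq_bigr _ (W_edge a)) -mulr_suml.
rewrite -mulr_suml.
rewrite [X in X + _](eq_bigr (fun a =>
    x a ^+ 2 * \sum_(u : m.*2.-tuple 'I_n.+1) W k u)); last first.
  by move=> a _; rewrite mulr_sumr; apply: eq_bigr => u _; exact: W_loop.
(* Loops in first position contribute the factor [m + 1 - num_edges k] and the other edges the sum
   of the [k a b], that is [num_edges k]. Together they give [m + 1], which turns [m!] into
   [(m + 1)!]. *)
rewrite -mulr_suml IH [X in X + _](_ : _ = m`!%:R * (edge_mass k *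
    ((m.+1%:R - (num_edges k)%:R) * loop_mass m.+1 (num_edges k)))); last first.
  by rewrite -loop_massS; ring.
have -> : \sum_(i < n.+1) \sum_(j < n.+1 | (i < j)%N) (k i j)%:R =
    (num_edges k)%:R :> R.
  by rewrite /num_edges natr_sum; apply: eq_bigr => i _; rewrite natr_sum.
by rewrite factS natrM; ring.
Qed.

Lemma sqr_sum_pairs : (\sum_i x i) ^+ 2 =
  \sum_i x i ^+ 2 + \sum_(i < n.+1) \sum_(j < n.+1 | (i < j)%N) 2 * x i * x j.
Proof.
rewrite expr2 mulr_suml; under eq_bigr do rewrite mulr_sumr.
rewrite sum_pairs; congr (_ + _); apply: eq_bigr => i _.
by apply: eq_bigr => j _; ring.
Qed.

Hypothesis x_gt0 : forall i, 0 < x i.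
Variable lam : R.
Hypothesis lam_gt0 : 0 < lam.

Let Q_ge0 : 0 <= \sum_i x i ^+ 2.
Proof. by apply: sumr_ge0 => i _; exact: sqr_ge0. Qed.

Lemma loop_mass_ge0 m s : 0 <= loop_mass m s.
Proof. by rewrite /loop_mass; case: ifP => // _; rewrite divr_ge0// exprn_ge0. Qed.

Lemma nneseries_loop_mass s :
  (\sum_(m <oo) (lam ^+ m * loop_mass m s)%:E =
  (lam ^+ s * expR (lam * \sum_i x i ^+ 2))%:E)%E.
Proof.
have t0 m s' : (0 <= (lam ^+ m * loop_mass m s')%:E)%E.
  by rewrite lee_fin mulr_ge0 ?loop_mass_ge0 ?exprn_ge0// ltW.
elim: s => [|s IH].
  rewrite expr0 mul1r -nneseries_expR; last by rewrite mulr_ge0// ltW.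
  apply: eq_eseriesr => m _.
  by rewrite /loop_mass leq0n subn0 exprMn mulrA.
rewrite nneseries_recl0// /loop_mass ltn0 mulr0 add0e -/loop_mass.
under eq_eseriesr do rewrite -/(loop_mass _ _) loop_massSS exprS -mulrA EFinM.
by rewrite nneseriesZl// IH -EFinM exprS mulrA.
Qed.

(** By [sqr_sum_pairs] the total rate of the edges that are not loops is [lam] times the square of
    the sum minus the sum of the squares. *)
Lemma prod_poisson_pmf k :
  \prod_(i < n.+1) \prod_(j < n.+1 | (i < j)%N)
    poisson_pmf (2 * lam * x i * x j) (k i j) =
  lam ^+ num_edges k * edge_mass k *
  expR (lam * \sum_i x i ^+ 2 - lam * (\sum_i x i) ^+ 2).
Proof.
rewrite sqr_sum_pairs mulrDr opprD addNKr.
transitivity (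
    \prod_(i < n.+1) \prod_(j < n.+1 | (i < j)%N) (lam ^+ k i j) *
    edge_mass k *
    \prod_(i < n.+1) \prod_(j < n.+1 | (i < j)%N) expR (- (lam * (2 * x i * x j)))).
  rewrite -!big_split/=; apply: eq_bigr => i _.
  rewrite -!big_split/=; apply: eq_bigr => j _.
  rewrite /poisson_pmf !mulr_gt0//; congr (_ * expR _); last by ring.
  have -> : 2 * lam * x i * x j = lam * (2 * x i * x j) by ring.
  by rewrite exprMn mulrA.
congr (_ * _ * _).
  rewrite /num_edges -prodrXr; apply: eq_bigr => i _.
  by rewrite prodrXr.
rewrite mulr_sumr -sumrN expR_sum; apply: eq_bigr => i _.
by rewrite mulr_sumr -sumrN expR_sum.
Qed.

(** Thinning of a Poisson number of pairs of mean [lam * S ^ 2]: the classes of pairs have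
    independent Poisson sizes, and the loops, of rates [lam * x i ^ 2], are summed out. The power
    [S ^ (2 m)] of the Poisson mass has cancelled against the normalization of the letters, which
    leaves bare weights. *)
Lemma poisson_splitting k :
  (\sum_(m <oo) (expR (- (lam * (\sum_i x i) ^+ 2)) * (lam ^+ m / m`!%:R) *
     \sum_(u : m.*2.-tuple 'I_n.+1 | has_edge_counts k u) weight u)%:E =
  (\prod_(i < n.+1) \prod_(j < n.+1 | (i < j)%N)
    poisson_pmf (2 * lam * x i * x j) (k i j))%:E)%E.
Proof.
transitivity (\sum_(m <oo) ((expR (- (lam * (\sum_i x i) ^+ 2)) * edge_mass k)%:E *
    (lam ^+ m * loop_mass m (num_edges k))%:E))%E.
  apply: eq_eseriesr => m _; rewrite sum_weight_edge_counts -EFinM; congr EFin.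
  by field; rewrite pnatr_eq0 -lt0n fact_gt0.
rewrite nneseriesZl; last first.
  by move=> m _; rewrite lee_fin mulr_ge0 ?loop_mass_ge0 ?exprn_ge0// ltW.
rewrite nneseries_loop_mass -EFinM prod_poisson_pmf expRD; congr EFin; ring.
Qed.

End poisson_splitting.

(** * The law of the number of edges and its independence from the word *)

Section edge_number.
Context (R : realType) (n : nat) (lam : R).
Hypothesis lam_gt0 : 0 < lam.
Local Open Scope ereal_scope.

Let lams_ge0 (s : R) : (0 <= lam * s ^+ 2)%R.
Proof. by rewrite mulr_ge0 ?sqr_ge0// ltW. Qed.

Let measurable_lams : measurable_fun [set: R] (fun s : R => lam * s ^+ 2)%R.
Proof. by apply: measurable_funM => //; exact: measurable_funX. Qed.

Lemma measurable_poisson_mass m :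
  measurable_fun [set: R] (fun s => poisson_mass m (lam * s ^+ 2)%R).
Proof.
apply: measurable_funM; first by apply: measurable_funM => //; exact: measurable_funX.
by do 2 apply: measurableT_comp => //.
Qed.

(** A mixed Poisson law: the variable [s] is the sum of [n + 1] exponential variables, whose density
    is [gamma_pdf n]. *)
Definition edge_number_pmf m : \bar R :=
  gamma_int n (fun s : R => (poisson_mass m (lam * s ^+ 2)%R)%:E).

Lemma edge_number_pmf_ge0 m : 0 <= edge_number_pmf m.
Proof. by apply: gamma_int_ge0 => s; rewrite lee_fin poisson_mass_ge0. Qed.

Lemma edge_number_mean (a : nat -> R) (f : R -> R) : (forall m, (0 <= a m)%R) ->
  (forall s, \sum_(m <oo) (poisson_mass m (lam * s ^+ 2) * a m)%:E = (f s)%:E) ->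
  \sum_(m <oo) (edge_number_pmf m * (a m)%:E) = gamma_int n (EFin \o f).
Proof.
move=> a0 af; rewrite /edge_number_pmf /gamma_int.
transitivity (\sum_(m <oo) \int[lebesgue_measure]_s
    ((poisson_mass m (lam * s ^+ 2) * a m)%:E * (gamma_pdf n s)%:E)).
  apply: eq_eseriesr => m _; rewrite -ge0_integralZr//.
  - by apply: eq_integral => s _; rewrite EFinM muleAC.
  - apply: emeasurable_funM; apply/measurable_EFinP.
      exact: measurable_poisson_mass.
    exact: measurable_gamma_pdf.
  - by move=> s _; rewrite mule_ge0 ?lee_fin ?gamma_pdf_ge0 ?poisson_mass_ge0.
  - by rewrite lee_fin.
rewrite -integral_nneseries//; last 2 first.
- move=> m; apply: emeasurable_funM; apply/measurable_EFinP.
    by apply: measurable_funM => //; exact: measurable_poisson_mass.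
  exact: measurable_gamma_pdf.
- move=> m s _; rewrite mule_ge0 ?lee_fin ?gamma_pdf_ge0//.
  by rewrite mulr_ge0 ?poisson_mass_ge0.
apply: eq_integral => s _.
under eq_eseriesr do rewrite muleC.
rewrite nneseriesZl; last first.
  by move=> m _; rewrite lee_fin mulr_ge0 ?poisson_mass_ge0.
by rewrite af muleC.
Qed.

Lemma gamma_int_mulXn j (f : R -> \bar R) : measurable_fun [set: R] f ->
  (forall x, 0 <= f x) ->
  gamma_int n (fun s => f s * (s ^+ j)%:E) =
  ((n + j)`!%:R / n`!%:R)%:E * gamma_int (n + j) f.
Proof.
move=> mf f0; rewrite /gamma_int -ge0_integralZl//.
- apply: eq_integral => s _; rewrite -muleA [RHS]muleCA -!EFinM.
  congr (_ * _%:E).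
  rewrite /gamma_pdf exprD; field.
  by rewrite !pnatr_eq0 -!lt0n !fact_gt0.
- apply: emeasurable_funM => //; apply/measurable_EFinP.
  exact: measurable_gamma_pdf.
- by move=> s _; rewrite mule_ge0// lee_fin gamma_pdf_ge0.
Qed.

Lemma gamma_int_Xn j :
  gamma_int n (fun s : R => (s ^+ j)%:E) = ((n + j)`!%:R / n`!%:R)%:E.
Proof.
transitivity (gamma_int n (fun s : R => cst 1 s * (s ^+ j)%:E)).
  by congr gamma_int; apply/funext => s; rewrite mul1e.
by rewrite gamma_int_mulXn// gamma_int1 mule1.
Qed.

Lemma gamma_intZ (k : R) j : (0 <= k)%R ->
  gamma_int n (fun s : R => (k * (s ^+ 2) ^+ j)%:E) =
  (k * ((n + j.*2)`!%:R / n`!%:R))%:E.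
Proof.
move=> k0; rewrite EFinM -gamma_int_Xn /gamma_int -ge0_integralZl//.
- by apply: eq_integral => s _; rewrite -exprM mul2n EFinM muleA.
- apply: emeasurable_funM; apply/measurable_EFinP; first exact: measurable_funX.
  exact: measurable_gamma_pdf.
- move=> s _; rewrite mule_ge0 ?lee_fin ?gamma_pdf_ge0//.
  by rewrite -mul2n exprM exprn_ge0// sqr_ge0.
Qed.

Lemma edge_number_mean0 : \sum_(m <oo) edge_number_pmf m = 1.
Proof.
transitivity (\sum_(m <oo) (edge_number_pmf m * (1%R : R)%:E)).
  by apply: eq_eseriesr => m _; rewrite mule1.
rewrite (@edge_number_mean (fun=> 1%R) (fun=> 1%R))//.
  exact: gamma_int1.
move=> s; under eq_eseriesr do rewrite mulr1.
exact: sum_poisson_mass.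
Qed.

Lemma edge_number_mean1 :
  \sum_(m <oo) (edge_number_pmf m * (m%:R)%:E) =
  (lam * (n.+1%:R * n.+2%:R))%:E.
Proof.
rewrite (@edge_number_mean (fun m => m%:R) (fun s => lam * (s ^+ 2) ^+ 1)%R)//.
  rewrite (gamma_intZ 1) ?ltW//= addn2 !factS !natrM; congr EFin; field.
  by rewrite pnatr_eq0 -lt0n fact_gt0.
by move=> s; exact: sum_poisson_mass1.
Qed.

Lemma edge_number_mean2 :
  \sum_(m <oo) (edge_number_pmf m * (m%:R * m.-1%:R)%:E) =
  (lam ^+ 2 * (n.+1%:R * n.+2%:R * n.+3%:R * n.+4%:R))%:E.
Proof.
rewrite (@edge_number_mean (fun m => m%:R * m.-1%:R)%R
  (fun s => lam ^+ 2 * (s ^+ 2) ^+ 2)%R).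
- rewrite (gamma_intZ 2) ?sqr_ge0//= addn4 !factS !natrM; congr EFin; field.
  by rewrite pnatr_eq0 -lt0n fact_gt0.
- by move=> m; rewrite mulr_ge0.
- by move=> s; rewrite sum_poisson_mass2// exprMn.
Qed.

(** The fourth powers of [N] cancel and leave [lam ^ 2 * (4 N^3 + 11 N^2 + 6 N) + lam * (N^2 + N)],
    whence 21 = 4 + 11 + 6. *)
Let variance_bound (N : R) : (1 <= N ->
  lam ^+ 2 * (N * (N + 1) * (N + 2) * (N + 3)) + lam * (N * (N + 1)) +
  (lam * N ^+ 2) ^+ 2 - 2 * (lam * N ^+ 2) * (lam * (N * (N + 1))) <=
  (21 * lam ^+ 2 + 2 * lam) * N ^+ 3)%R.
Proof.
move=> N1.
have NN : (N <= N ^+ 2)%R by rewrite expr2 ler_peMl// (le_trans _ N1).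
have N3 : (N ^+ 2 <= N ^+ 3)%R.
  by rewrite [leRHS]exprS ler_peMl// sqr_ge0.
have l2 : (0 <= lam ^+ 2)%R by exact: sqr_ge0.
have h1 : (0 <= lam ^+ 2 * (17 * N ^+ 3 - 11 * N ^+ 2 - 6 * N))%R.
  by rewrite mulr_ge0//; lra.
have h2 : (0 <= lam * (2 * N ^+ 3 - N ^+ 2 - N))%R.
  by rewrite mulr_ge0 ?(ltW lam_gt0)//; lra.
rewrite -subr_ge0; apply: le_trans (addr_ge0 h1 h2) _.
by rewrite le_eqVlt; apply/orP; left; apply/eqP; ring.
Qed.

(** The centre is not the mean [lam * n.+1 * n.+2] but [lam * n.+1 ^ 2], which is within 1 of the
    number of edges of the urn graph. The two centres differ by [lam * n.+1], which does not affect
    the order. *)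
Lemma edge_number_variance :
  \sum_(m <oo) (edge_number_pmf m * ((m%:R - lam * n.+1%:R ^+ 2) ^+ 2)%:E) <=
  ((21 * lam ^+ 2 + 2 * lam) * n.+1%:R ^+ 3)%:E.
Proof.
set mu := (lam * n.+1%:R ^+ 2)%R; set V := \sum_(m <oo) _.
have mu0 : (0 <= mu)%R by rewrite mulr_ge0 ?exprn_ge0// ltW.
(* The cross term of the square is moved to the left, so that every series has nonnegative terms and
   can be split. *)
have E : V + (2 * mu * (lam * (n.+1%:R * n.+2%:R)))%:E =
    (lam ^+ 2 * (n.+1%:R * n.+2%:R * n.+3%:R * n.+4%:R) +
     lam * (n.+1%:R * n.+2%:R) + mu ^+ 2)%:E.
  pose S (a : nat -> R) := \sum_(m <oo) (edge_number_pmf m * (a m)%:E).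
  have SD (a b : nat -> R) : (forall m, (0 <= a m)%R) -> (forall m, (0 <= b m)%R) ->
      S (fun m => a m + b m)%R = S a + S b.
    move=> a0 b0; rewrite /S -nneseriesD.
    - by apply: eq_eseriesr => m _; rewrite EFinD ge0_muleDr// lee_fin.
    - by move=> m _; rewrite mule_ge0 ?edge_number_pmf_ge0// lee_fin.
    - by move=> m _; rewrite mule_ge0 ?edge_number_pmf_ge0// lee_fin.
  have SZ (k : R) (a : nat -> R) : (0 <= k)%R -> (forall m, (0 <= a m)%R) ->
      S (fun m => k * a m)%R = k%:E * S a.
    move=> k0 a0; rewrite /S -nneseriesZl.
      by apply: eq_eseriesr => m _; rewrite EFinM muleCA.
    by move=> m _; rewrite mule_ge0 ?edge_number_pmf_ge0// lee_fin.
  have S1 : S (fun=> 1%R) = 1.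
    by rewrite -edge_number_mean0; apply: eq_eseriesr => m _; rewrite mule1.
  have mu2 : (0 <= 2 * mu)%R by rewrite mulr_ge0.
  rewrite [in LHS]EFinM -edge_number_mean1 -/(S (fun m => m%:R)) -SZ//.
  have -> : V = S (fun m => (m%:R - mu) ^+ 2)%R by [].
  rewrite -SD; [|by move=> m; exact: sqr_ge0|by move=> m; exact: mulr_ge0].
  rewrite !EFinD -edge_number_mean2 -edge_number_mean1.
  rewrite -/(S (fun m => m%:R)) -/(S (fun m => m%:R * m.-1%:R)%R).
  rewrite -[(mu ^+ 2)%:E]mule1 -S1 -SZ ?sqr_ge0//.
  have a0 m : (0 <= m%:R * m.-1%:R :> R)%R by rewrite mulr_ge0.
  have b0 m : (0 <= m%:R * m.-1%:R + m%:R :> R)%R by rewrite addr_ge0.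
  rewrite -SD// -SD//; last by move=> _; rewrite mulr1 sqr_ge0.
  (* The value 0 is treated apart because [m.-1] is truncated there. *)
  congr S; apply/funext => -[|m]; first by rewrite /=; ring.
  by rewrite -natr1 /=; ring.
rewrite (_ : V = (lam ^+ 2 * (n.+1%:R * n.+2%:R * n.+3%:R * n.+4%:R) +
     lam * (n.+1%:R * n.+2%:R) + mu ^+ 2 - 2 * mu * (lam * (n.+1%:R * n.+2%:R)))%:E).
  rewrite lee_fin /mu.
  set N : R := n.+1%:R; have N1 : (1 <= N)%R by rewrite ler1n.
  have -> : n.+2%:R = (N + 1)%R by rewrite natr1.
  have -> : n.+3%:R = (N + 2)%R by rewrite -natrD addn2.
  have -> : n.+4%:R = (N + 3)%R by rewrite -natrD addn3.
  clearbody N.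
  exact: variance_bound.
by rewrite EFinB -E addeK.
Qed.

(** Given the sample [t], the conditional probability that the word of the edges is [u]: a Poisson
    mass times the normalized letter weights, with the powers of [norm_sum t] cancelled. *)
Definition word_density (u : seq 'I_n.+1) (t : n.+1.-tuple R) : R :=
  (expR (- (lam * norm_sum t ^+ 2)) * (lam ^+ (size u)./2 / ((size u)./2)`!%:R) *
   weight (fun v => `|tnth t v|) u)%R.

Lemma weight_ge0 (x : 'I_n.+1 -> R) u : (forall i, (0 <= x i)%R) ->
  (0 <= weight x u)%R.
Proof. by move=> x0; apply: prodr_ge0. Qed.

Lemma word_density_ge0 u t : (0 <= word_density u t)%R.
Proof.
rewrite !mulr_ge0 ?expR_ge0 ?invr_ge0 ?exprn_ge0 ?weight_ge0//; exact: ltW.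
Qed.

Lemma weight_monomial u (t : n.+1.-tuple R) :
  weight (fun v => `|tnth t v|%R) u = monomial (fun v => count_mem v u) t.
Proof.
elim: u => [|a u IH]; first by rewrite /weight big_nil /monomial big1.
rewrite /weight big_cons -/(weight _ u) IH /monomial.
rewrite (bigD1 a)//= [in RHS](bigD1 a)//= eqxx add1n exprS mulrA; congr (_ * _)%R.
by apply: eq_bigr => i ia; rewrite eq_sym (negbTE ia).
Qed.

Lemma measurable_word_density u : measurable_fun [set: n.+1.-tuple R] (word_density u).
Proof.
apply: measurable_funM.
  apply: measurable_funM => //; do 2 apply: measurableT_comp => //.
  by apply: (measurableT_comp measurable_lams); exact: measurable_norm_sum.
rewrite (_ : (fun t => _) = monomial (fun v => count_mem v u)).
  exact: measurable_monomial.
by apply/funext => t; rewrite weight_monomial.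
Qed.

(** The product form says that, once the sample is integrated out, the word is an urn word
    independent of the number of edges. By [integral_monomial] the letters enter only through the
    factorials of their counts, which make up [polya], and through the length. *)
Lemma integral_word_density m u : size u = m.*2 ->
  \int[iid_prob (@exp1 R) n.+1]_t (word_density u t)%:E =
  (polya R u)%:E * edge_number_pmf m.
Proof.
move=> um.
pose h (s : R) := (expR (- (lam * s ^+ 2)) * (lam ^+ m / m`!%:R))%:E.
have h0 s : 0 <= h s.
  by rewrite lee_fin mulr_ge0 ?expR_ge0// divr_ge0 ?exprn_ge0// ltW.
have mh : measurable_fun setT h.
  apply/measurable_EFinP; apply: measurable_funM => //.
  by do 2 apply: measurableT_comp => //.
transitivity (\int[iid_prob (@exp1 R) n.+1]_t
    (h (norm_sum t) * (monomial (fun v => count_mem v u) t)%:E)).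
  apply: eq_integral => t _.
  by rewrite /word_density um doubleK weight_monomial -EFinM.
rewrite integral_monomial//.
have -> : (\sum_(i < n.+1) count_mem i u + n.+1 = (n + m.*2).+1)%N.
  have := sum_count_mem u; rewrite um; under eq_bigr do rewrite -addn1.
  by rewrite big_split/= sum1_card card_ord addSn.
rewrite -gamma_int_iter//.
(* The [m.*2] extra shifts are traded for the factor [s ^ (2 m)], which completes the Poisson
   mass. *)
have -> : edge_number_pmf m = gamma_int n (fun s => h s * (s ^+ m.*2)%:E).
  congr gamma_int; apply/funext => s; rewrite -EFinM /poisson_mass exprMn -exprM mul2n.
  by congr EFin; ring.
rewrite gamma_int_mulXn// muleA -EFinM; congr (_%:E * _).
rewrite /polya um; field.
by rewrite !pnatr_eq0 -!lt0n !fact_gt0.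
Qed.

End edge_number.

(** * The space of the W-graph *)

Section finite_sum_measure.
Context d (T : measurableType d) (R : realType) (I : finType).
Local Open Scope ereal_scope.
Variable m_ : I -> {measure set T -> \bar R}.

Let m' (k : nat) : {measure set T -> \bar R} :=
  if insub k is Some j then m_ (enum_val (j : 'I_#|I|)) else mzero.

Definition fin_msum : set T -> \bar R := msum m' #|I|.

HB.instance Definition _ := Measure.on fin_msum.

Let sum_ord (F : {measure set T -> \bar R} -> \bar R) :
  \sum_(k < #|I|) F (m' k) = \sum_i F (m_ i).
Proof.
rewrite [RHS](reindex (@enum_val _ [pred _ : I | true])); last first.
  exists enum_rank => [j _|i _]; [exact: enum_valK|exact: enum_rankK].
by apply: eq_big => // j; rewrite /m' valK.
Qed.

Lemma fin_msumE A : fin_msum A = \sum_i m_ i A.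
Proof. exact: (sum_ord (fun mu => mu A)). Qed.

Lemma ge0_integral_fin_msum (f : T -> \bar R) : measurable_fun setT f ->
  (forall x, 0 <= f x) -> \int[fin_msum]_x f x = \sum_i \int[m_ i]_x f x.
Proof.
move=> mf f0; rewrite ge0_integral_measure_sum//.
exact: (sum_ord (fun mu => \int[mu]_x f x)).
Qed.

End finite_sum_measure.

Definition word_space (n : nat) : Type := seq 'I_n.+1.
HB.instance Definition _ n := Choice.on (word_space n).
HB.instance Definition _ n := isPointed.Build (word_space n) [::].
HB.instance Definition _ n := @isMeasurable.Build default_measure_display
  (word_space n) discrete_measurable discrete_measurable0
  discrete_measurableC discrete_measurableU.

Section word_mixture.
Context d (T : measurableType d) (R : realType) (n : nat).
Local Open Scope ereal_scope.
Variables (L : nat -> nat) (piece : nat -> seq 'I_n.+1 -> {measure set T -> \bar R}).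

(** Used twice: with words of length [m.*2] for the space of the W-graph, and with longer words for
    the coupling. *)
Definition word_mixture : set T -> \bar R :=
  mseries (fun m => fin_msum (fun u : (L m).-tuple 'I_n.+1 => piece m u)) 0.

HB.instance Definition _ := Measure.on word_mixture.

Lemma word_mixtureE A :
  word_mixture A = \sum_(m <oo) \sum_(u : (L m).-tuple 'I_n.+1) piece m u A.
Proof. by apply: eq_eseriesr => m _; exact: fin_msumE. Qed.

Lemma ge0_integral_word_mixture (f : T -> \bar R) : measurable_fun setT f ->
  (forall x, 0 <= f x) -> \int[word_mixture]_x f x =
    \sum_(m <oo) \sum_(u : (L m).-tuple 'I_n.+1) \int[piece m u]_x f x.
Proof.
move=> mf f0; rewrite ge0_integral_measure_series//.
by apply: eq_eseriesr => m _; exact: ge0_integral_fin_msum.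
Qed.

End word_mixture.

Section w_space.
Context (R : realType) (n : nat) (lam : R).
Hypothesis lam_gt0 : (0 < lam)%R.
Local Open Scope ereal_scope.
Local Notation iid := (iid_prob (@exp1 R) n.+1).
Local Notation space := (n.+1.-tuple R * word_space n)%type.

Definition w_piece (u : seq 'I_n.+1) : {measure set space -> \bar R} :=
  measure_function_pushforward__canonical__measure_function_Measure
    (mdensity iid (measurable_word_density lam u) (word_density_ge0 lam_gt0 u))
    (pair2_measurable (u : word_space n)).

Definition w_measure : set space -> \bar R := word_mixture double (fun=> w_piece).

HB.instance Definition _ := Measure.on w_measure.

(** The conditional probability, given the sample, that the word lies in [D]; [w_measure]
    disintegrates over the sample with this kernel. *)
Definition words_density (D : set (word_space n)) (t : n.+1.-tuple R) : \bar R :=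
  \sum_(m <oo) \sum_(u : m.*2.-tuple 'I_n.+1)
    (if (u : word_space n) \in D then word_density lam u t else 0%R)%:E.

Let words_density_term_ge0 (D : set (word_space n)) m t :
  0 <= \sum_(u : m.*2.-tuple 'I_n.+1)
    (if (u : word_space n) \in D then word_density lam u t else 0%R)%:E.
Proof.
apply: sume_ge0 => u _; rewrite lee_fin; case: ifP => // _.
exact: word_density_ge0.
Qed.

Let measurable_term (D : set (word_space n)) (u : word_space n) :
  measurable_fun [set: n.+1.-tuple R] (fun t => (if u \in D then word_density lam u t else 0%R)%:E).
Proof.
apply/measurable_EFinP; case: (u \in D); last exact: measurable_cst.
exact: measurable_word_density.
Qed.

Lemma words_density_ge0 D t : 0 <= words_density D t.
Proof. exact: nneseries_ge0. Qed.

Lemma measurable_words_density D :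
  measurable_fun [set: n.+1.-tuple R] (words_density D).
Proof.
apply: ge0_emeasurable_sum => [m t _ _|m _]; first exact: words_density_term_ge0.
by apply: emeasurable_sum => u; exact: measurable_term.
Qed.

Lemma w_measure_cylinder B D : measurable B ->
  w_measure (B `*` D) = \int[iid]_(t in B) words_density D t.
Proof.
move=> mB; rewrite /w_measure word_mixtureE integral_nneseries//; last first.
  move=> m; apply: measurable_funTS; apply: emeasurable_sum => u.
  exact: measurable_term.
apply: eq_eseriesr => m _; rewrite ge0_integral_sum//; last 2 first.
- by move=> u; apply: measurable_funTS; exact: measurable_term.
- by move=> u t _; rewrite lee_fin; case: ifP => // _; exact: word_density_ge0.
apply: eq_bigr => u _; rewrite /w_piece/= /pushforward /mdensity.
have [uD|uD] := boolP ((u : word_space n) \in D); last first.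
  rewrite integral0 (_ : _ @^-1` _ = set0) ?integral_set0//.
  by apply/seteqP; split => // t /= [_] /=; rewrite -(in_setE D) (negbTE uD).
congr integral; apply/seteqP; split => [t [] //|t Bt].
by split => //=; rewrite -in_setE.
Qed.

Lemma words_density_setT t : words_density setT t = 1.
Proof.
rewrite -(@sum_poisson_mass R (lam * norm_sum t ^+ 2)%R); last first.
  by rewrite mulr_ge0 ?sqr_ge0// ltW.
apply: eq_eseriesr => m _; rewrite sumEFin; congr EFin.
under eq_bigr do rewrite in_setT /word_density size_tuple doubleK.
rewrite -mulr_sumr sum_weight -/(norm_sum t) /poisson_mass exprMn -exprM mul2n.
by ring.
Qed.

Lemma w_measure_fst B : measurable B -> w_measure (fst @^-1` B) = iid B.
Proof.
move=> mB; rewrite (_ : _ @^-1` _ = B `*` setT); last first.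
  by apply/seteqP; split => // z [].
rewrite w_measure_cylinder//; under eq_integral do rewrite words_density_setT.
by rewrite integral_cst// mul1e.
Qed.

Let w_measure_setT : w_measure setT = 1.
Proof. by rewrite -(preimage_setT fst) w_measure_fst// probability_setT. Qed.

HB.instance Definition _ := Measure_isProbability.Build _ _ _ w_measure w_measure_setT.

Lemma ge0_integral_w_measure_fst B (f : n.+1.-tuple R -> \bar R) : measurable B ->
  measurable_fun setT f -> (forall t, 0 <= f t) ->
  \int[w_measure]_(z in fst @^-1` B) f z.1 = \int[iid]_(t in B) f t.
Proof.
move=> mB mf f0.
have mfst : measurable_fun [set: space] fst by [].
rewrite -(ge0_integral_pushforward mfst w_measure mB)//; last exact: measurable_funTS.
by apply: eq_measure_integral => A mA _; exact: w_measure_fst.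
Qed.

End w_space.

Section w_variables.
Context (R : realType) (n : nat) (lam : R).
Hypothesis lam_gt0 : (0 < lam)%R.
Local Notation iid := (iid_prob (@exp1 R) n.+1).
Local Notation space := (n.+1.-tuple R * word_space n)%type.
Local Notation w_measure := (w_measure lam_gt0).

Definition w_xi (i : 'I_n.+1) (z : space) : R := tnth z.1 i.

Lemma measurable_w_xi i : measurable_fun [set: space] (w_xi i).
Proof. exact: (measurableT_comp (measurable_tnth i) measurable_fst). Qed.

HB.instance Definition _ i :=
  isMeasurableFun.Build _ _ _ _ (w_xi i) (measurable_w_xi i).

Definition w_edges (i j : 'I_n.+1) (z : space) : nat :=
  edge_count (z.2 : seq 'I_n.+1) i j.

Lemma measurable_w_edges i j : measurable_fun [set: space] (w_edges i j).
Proof.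
move=> _ A mA.
have mB : measurable [set u : word_space n | A (edge_count u i j)] by [].
exact: (measurable_snd measurableT _ mB).
Qed.

HB.instance Definition _ i j :=
  isMeasurableFun.Build _ _ _ _ (w_edges i j) (measurable_w_edges i j).

Lemma iid_coordinate i (B : set R) : measurable B ->
  iid [set t | B (tnth t i)] = exponential_prob 1 B.
Proof.
move=> mB; rewrite (_ : [set t | _] = [set t | forall j : 'I_n.+1,
    (if j == i then B else setT) (tnth t j)]); last first.
  apply/seteqP; split => [t /= Bt j|t /= /(_ i)]; last by rewrite eqxx.
  by case: eqP => [->|].
transitivity (\prod_(j < n.+1) @exp1 R (if j == i then B else setT))%E.
  apply: (iid_prob_rectangle _ (B := fun j => if j == i then B else setT)) => j.
  by case: ifP.
rewrite (bigD1 i)//= eqxx big1 ?mule1// => j /negbTE ->.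
exact: probability_setT.
Qed.

Lemma w_xi_law i (B : set R) : measurable B ->
  distribution w_measure (w_xi i) B = exponential_prob 1 B.
Proof.
move=> mB; rewrite -(iid_coordinate i mB) -(w_measure_fst lam_gt0)//.
rewrite -[X in measurable X]setTI; exact: measurable_tnth.
Qed.

Lemma w_xi_independent : mutually_independent (P := w_measure) w_xi.
Proof.
move=> J B mB; pose C j := if j \in J then B j else setT.
have mC j : measurable (C j) by rewrite /C; case: ifP.
have mt i (A : set R) : measurable A ->
    measurable [set t : n.+1.-tuple R | A (tnth t i)].
  by move=> mA; rewrite -[X in measurable X]setTI; exact: measurable_tnth.
transitivity (iid [set t | forall j, C j (tnth t j)]).
  rewrite -(w_measure_fst lam_gt0).
    congr w_measure; apply/seteqP; split => z /= H j.
      by rewrite /C; case: ifP => // jJ; exact: H.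
    by move=> jJ; have := H j; rewrite /C jJ.
  rewrite (_ : [set t | _] =
      \bigcap_(j in [set: 'I_n.+1]) [set t | C j (tnth t j)]); last first.
    by apply/seteqP; split => t H j => [_|]; exact: H.
  by apply: fin_bigcap_measurable => // j _; exact: mt.
transitivity (\prod_(j < n.+1) @exp1 R (C j))%E; first exact: iid_prob_rectangle.
rewrite [RHS]big_mkcond; apply: eq_bigr => j _.
rewrite /C; case: ifP => _; last exact: probability_setT.
rewrite (_ : exp1 (B j) = exponential_prob 1 (B j))// -(iid_coordinate j (mB j)).
by rewrite -(w_measure_fst lam_gt0)//; exact: mt.
Qed.

Let nonpos (k : nat) : set (n.+1.-tuple R) := [set t | (tnth t (inord k) <= 0)%R].

Let measurable_nonpos k : measurable (nonpos k).
Proof.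
rewrite (_ : nonpos k = (fun t => tnth t (inord k)) @^-1` `]-oo, 0%R]); last first.
  by apply/seteqP; split => t /=; rewrite in_itv.
by rewrite -[X in measurable X]setTI; exact: measurable_tnth.
Qed.

Let exists_nonpos : [set t : n.+1.-tuple R | exists i, (tnth t i <= 0)%R] =
  \big[setU/set0]_(i < n.+1) nonpos i.
Proof.
rewrite -bigcup_mkord; apply/seteqP; split => [t [i ti]|t [k kn tk]].
  by exists i => //=; rewrite /nonpos/= inord_val.
by exists (inord k).
Qed.

Lemma measurable_exists_nonpos :
  measurable [set t : n.+1.-tuple R | exists i, (tnth t i <= 0)%R].
Proof. by rewrite exists_nonpos; exact: bigsetU_measurable. Qed.

Lemma iid_exists_nonpos : iid [set t | exists i, (tnth t i <= 0)%R] = 0%E.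
Proof.
rewrite exists_nonpos; apply/eqP; rewrite eq_le measure_ge0 andbT.
apply: le_trans (Boole_inequality _ _) _ => //.
rewrite big1// => i _.
rewrite (_ : nonpos i = [set t | `]-oo, 0%R]%classic (tnth t i)]); last first.
  by apply/seteqP; split => t /=; rewrite in_itv /nonpos/= inord_val.
transitivity (@exponential_prob R 1 `]-oo, 0%R]); first exact: iid_coordinate.
rewrite /exponential_prob.
rewrite -integral_itv_bndo_bndc; last first.
  apply/measurable_EFinP/measurable_funTS; exact: measurable_exponential_pdf.
apply: integral0_eq => x /=; rewrite in_itv/= => x0.
by rewrite lt0_exponential_pdf.
Qed.

(** An event generated by the [w_xi] is a set [B] of samples, so the joint event is a cylinder. Its
    probability is an integral over [B] of the kernel, which Poisson splitting evaluates. *)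
Lemma w_conditionally_poisson :
  conditionally_poisson (2 * lam) (P := w_measure) w_xi w_edges.
Proof.
move=> E k; rewrite [X in X E](_ : _ = preimage_set_system [set: space] fst
    (g_sigma_preimage (fun i (t : n.+1.-tuple R) => tnth t i))); last first.
  by rewrite -g_sigma_preimage_comp.
move=> [B mB]; rewrite setTI => <-{E}.
have {}mB : measurable B by exact: mB.
pose D : set (word_space n) := [set u | has_edge_counts k u].
rewrite (_ : _ `&` _ = B `*` D); last first.
  by apply/seteqP; split => -[t u] [/= Bt] Du; split => //=; exact/has_edge_countsP.
transitivity (\int[iid]_(t in B) words_density lam D t)%E.
  exact: w_measure_cylinder.
pose F (t : n.+1.-tuple R) := (\prod_(i < n.+1) \prod_(j < n.+1 | (i < j)%N)
    poisson_pmf (2 * lam * tnth t i * tnth t j) (k i j))%R.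
have mF : measurable_fun setT (EFin \o F).
  apply/measurable_EFinP; apply: measurable_prod => i _.
  under eq_fun do rewrite big_mkcond.
  apply: measurable_prod => j _; case: (i < j)%N; last exact: measurable_cst.
  apply: (measurableT_comp (f := fun r : R => poisson_pmf r (k i j))).
    exact: measurable_poisson_pmf.
  apply: measurable_funM; last exact: measurable_tnth.
  by apply: measurable_funM => //; exact: measurable_tnth.
have F0 t : (0 <= (F t)%:E)%E.
  rewrite lee_fin; apply: prodr_ge0 => i _; apply: prodr_ge0 => j _.
  exact: poisson_pmf_ge0.
rewrite -[RHS]/(\int[w_measure]_(z in fst @^-1` B) (EFin \o F) z.1)%E.
rewrite (ge0_integral_w_measure_fst lam_gt0)//.
(* The integrands agree only where all coordinates are positive, which is what [poisson_splitting]
   requires; the other samples form a null set. *)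
apply: ge0_ae_eq_integral => //.
- exact: measurable_funTS (measurable_words_density _ _).
- exact: measurable_funTS.
- by move=> t _; exact: words_density_ge0.
- by move=> t _; exact: F0.
- have N0 : (iid).-negligible [set t | exists i, (tnth t i <= 0)%R].
    exists [set t | exists i, (tnth t i <= 0)%R]; split => //.
      exact: measurable_exists_nonpos.
    exact: iid_exists_nonpos.
  apply: (negligibleS _ N0) => t /=; apply: contra_notP => /forallNP tpos Bt.
  have t0 i : (0 < tnth t i)%R by rewrite ltNge; apply/negP.
  rewrite /words_density /= -(poisson_splitting t0 lam_gt0).
  apply: eq_eseriesr => m _; rewrite sumEFin; congr EFin.
  rewrite [X in (_ * X)%R]big_mkcond mulr_sumr; apply: eq_bigr => u _.
  have -> : (u : word_space n) \in D = has_edge_counts k u.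
    by apply/idP/idP; rewrite inE.
  case: ifP; rewrite ?mulr0// => _; rewrite /word_density size_tuple doubleK.
  have tE i : `|tnth t i|%R = tnth t i by rewrite gtr0_norm.
  congr (expR (- (_ * _ ^+ 2)) * _ * _).
    by apply: eq_bigr => i _; exact: tE.
  by apply: eq_bigr => i _; exact: tE.
Qed.

End w_variables.

(** * The coupling *)

Definition coupling_space (n : nat) : Type := (nat * seq 'I_n.+1)%type.
HB.instance Definition _ n := Choice.on (coupling_space n).
HB.instance Definition _ n := isPointed.Build (coupling_space n) (0%N, [::]).
HB.instance Definition _ n := @isMeasurable.Build default_measure_display
  (coupling_space n) discrete_measurable discrete_measurable0
  discrete_measurableC discrete_measurableU.

Section coupling.
Context (R : realType) (n : nat) (lam : R).
Hypothesis lam_gt0 : (0 < lam)%R.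
Local Notation N := (Num.truncn (2 * lam * n.+1%:R ^+ 2)).
Local Notation space := (coupling_space n).
Local Open Scope ereal_scope.

Definition edge_number_prob m : R := fine (edge_number_pmf n lam m).

Lemma edge_number_prob_ge0 m : (0 <= edge_number_prob m)%R.
Proof. by apply: fine_ge0; exact: edge_number_pmf_ge0. Qed.

Lemma edge_number_probE m : edge_number_pmf n lam m = (edge_number_prob m)%:E.
Proof.
rewrite fineK// ge0_fin_numE ?edge_number_pmf_ge0//.
apply: (@le_lt_trans _ _ 1); last exact: ltry.
rewrite -(edge_number_mean0 n lam_gt0) (nneseries_split 0 m.+1); last first.
  by move=> k _; exact: edge_number_pmf_ge0.
rewrite add0n big_mkord big_ord_recr/= -addeA addeC -addeA leeDl//.
by rewrite adde_ge0 ?sume_ge0 ?nneseries_ge0// => k *; exact: edge_number_pmf_ge0.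
Qed.

Lemma sum_edge_number_prob : \sum_(m <oo) (edge_number_prob m)%:E = 1.
Proof.
rewrite -(edge_number_mean0 n lam_gt0).
by apply: eq_eseriesr => m _; rewrite edge_number_probE.
Qed.

(* The first N letters serve the urn process, the first 2m letters the edges
   of the W-graph. *)
Definition word_length m : nat := maxn N m.*2.

Definition coupling_piece m (u : seq 'I_n.+1) : {measure set space -> \bar R} :=
  mscale (NngNum (mulr_ge0 (edge_number_prob_ge0 m) (polya_ge0 R u)))
    \d_((m, u) : space).

Definition coupling_measure : set space -> \bar R :=
  word_mixture word_length coupling_piece.

HB.instance Definition _ := Measure.on coupling_measure.

Lemma ge0_integral_coupling_measure (f : space -> R) : (forall z, (0 <= f z)%R) ->
  \int[coupling_measure]_z (f z)%:E = \sum_(m <oo) (edge_number_prob m *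
    polya_mean (word_length m) (fun u => f (m, u)))%:E.
Proof.
move=> f0; have mf : measurable_fun [set: space] (EFin \o f) by [].
rewrite ge0_integral_word_mixture//.
apply: eq_eseriesr => m _; rewrite mulr_sumr -sumEFin; apply: eq_bigr => u _.
have fe0 z : setT z -> 0 <= (f z)%:E by rewrite lee_fin.
rewrite ge0_integral_mscale// mulrA [RHS]EFinM; congr (_ * _).
have := integral_dirac ((m, val u) : space) measurableT mf.
by rewrite diracT mul1e.
Qed.

Lemma coupling_measureE (A : set space) :
  coupling_measure A = \sum_(m <oo) (edge_number_prob m *
    polya_mean (word_length m) (fun u => (((m, u) : space) \in A)%:R))%:E.
Proof.
rewrite /coupling_measure word_mixtureE.
apply: eq_eseriesr => m _; rewrite mulr_sumr -sumEFin; apply: eq_bigr => u _.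
by rewrite /coupling_piece/= /mscale/= diracE -EFinM mulrA.
Qed.

Lemma coupling_measure_cst (A : set space) (p : R) :
  (forall m, polya_mean (word_length m) (fun u => (((m, u) : space) \in A)%:R) = p) ->
  coupling_measure A = p%:E.
Proof.
move=> Ap; have p0 : (0 <= p)%R by rewrite -(Ap 0%N) polya_mean_ge0.
rewrite coupling_measureE; under eq_eseriesr do rewrite Ap mulrC EFinM.
rewrite nneseriesZl ?sum_edge_number_prob ?mule1// => m _.
by rewrite lee_fin edge_number_prob_ge0.
Qed.

Let coupling_measure_setT : coupling_measure setT = 1.
Proof.
apply: coupling_measure_cst => m.
rewrite -[RHS](polya_mean_cst n (word_length m)).
by apply: eq_polya_mean => u _; rewrite in_setT.
Qed.

HB.instance Definition _ :=
  Measure_isProbability.Build _ _ _ coupling_measure coupling_measure_setT.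

Definition coupling_draw (t : nat) (z : space) : 'I_n.+1 := nth ord0 z.2 t.

Definition coupling_pag (z : space) : multigraph n.+1 :=
  pag_multigraph N (fun t => coupling_draw t z).

Definition coupling_w (z : space) : multigraph n.+1 :=
  word_w_multigraph (take z.1.*2 z.2).

Lemma measurable_coupling_pag : measurable_fun [set: space] coupling_pag.
Proof. by []. Qed.

HB.instance Definition _ :=
  isMeasurableFun.Build _ _ _ _ coupling_pag measurable_coupling_pag.

Lemma measurable_coupling_w : measurable_fun [set: space] coupling_w.
Proof. by []. Qed.

HB.instance Definition _ :=
  isMeasurableFun.Build _ _ _ _ coupling_w measurable_coupling_w.

Lemma polya_mean_eq L (s : seq 'I_n.+1) : size s = L ->
  polya_mean L (fun u => (u == s)%:R) = polya R s.
Proof.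
move=> <-; rewrite /polya_mean (bigD1 (in_tuple s))//= eqxx mulr1 big1 ?addr0// => u us.
rewrite (_ : (_ == _) = false) ?mulr0//; apply: contraNF us => /eqP us.
exact/eqP/val_inj.
Qed.

(** The length of the word depends on [m] but is at least [N], and by consistency a prefix of at
    most [N] letters has the same law whatever the length. *)
Lemma coupling_measure_prefix (s : seq 'I_n.+1) (A : set space) : (size s <= N)%N ->
  (forall m u, (N <= size u)%N -> A (m, u) <-> take (size s) u = s) ->
  coupling_measure A = (polya R s)%:E.
Proof.
move=> sN As; apply: coupling_measure_cst => m.
have NL : (N <= word_length m)%N by exact: leq_maxl.
rewrite -(polya_mean_eq erefl) -(polya_mean_take _ (leq_trans sN NL)).
apply: eq_polya_mean => u uL /=; congr (nat_of_bool _)%:R.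
have Nu : (N <= size u)%N by rewrite uL.
apply/idP/eqP => [|us]; first by rewrite inE => /(As m u Nu).
by rewrite inE; apply/(As m u Nu).
Qed.

Lemma take_eq_mkseq (u : seq 'I_n.+1) (w : nat -> 'I_n.+1) t : (t <= size u)%N ->
  (forall s, (s < t)%N -> nth ord0 u s = w s) <-> take t u = mkseq w t.
Proof.
move=> tu; split => [H|H s st].
  apply: (@eq_from_nth _ ord0); first by rewrite size_takel// size_mkseq.
  by move=> s; rewrite size_takel// => st; rewrite nth_take// nth_mkseq// H.
by rewrite -(nth_take ord0 st) H nth_mkseq.
Qed.

Lemma coupling_urn_process :
  urn_process coupling_measure N coupling_draw.
Proof.
split => [//|t w v tN].
have history_prob t' w' : (t' <= N)%N ->
    coupling_measure (history coupling_draw w' t') = (polya R (mkseq w' t'))%:E.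
  move=> t'N; apply: coupling_measure_prefix; rewrite size_mkseq// => m u Nu.
  by apply: take_eq_mkseq; exact: leq_trans Nu.
(* With the value at [t] changed to [v], the history and the next draw together form the history of
   length [t + 1] of [w']. *)
pose w' s := if s == t then v else w s.
have mkw' : mkseq w' t = mkseq w t.
  apply/eq_in_map => s; rewrite mem_iota add0n /w' => /andP[_].
  by case: ltngtP.
rewrite (_ : _ `&` _ = history coupling_draw w' t.+1); last first.
  apply/seteqP; split => z.
    move=> [H zt] s; rewrite ltnS leq_eqVlt /w' => /orP[/eqP ->|st].
      by rewrite eqxx.
    by rewrite ltn_eqF//; exact: H.
  move=> H; split => [s st|].
    by have := H s (ltnW st); rewrite /w' ltn_eqF.
  by have := H t (ltnSn t); rewrite /w' eqxx.
apply: etrans (history_prob _ _ tN) _.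
transitivity ((polya R (mkseq w t))%:E *
    ((balls w t v)%:R / (\sum_(u < n.+1) balls w t u)%N%:R)%:E); last first.
  by congr (_ * _); apply/esym/history_prob/ltnW.
rewrite mkseqS mkw' /w' eqxx polya_rcons size_mkseq -EFinM.
have ballsE x : balls w t x = (count_mem x (mkseq w t)).+1.
  rewrite /balls add1n; congr _.+1; rewrite count_map -sum1_count -big_mkcond/=.
  by rewrite -(big_mkord (fun s => w s == x) (fun=> 1%N)) /index_iota subn0.
rewrite ballsE; under [in RHS]eq_bigr do rewrite ballsE.
by rewrite sum_count_mem size_mkseq.
Qed.

Lemma coupling_pag_law :
  pag_law (2 * lam) (P := coupling_measure) coupling_pag.
Proof.
exists _, space, coupling_measure, coupling_draw; split => //.
exact: coupling_urn_process.
Qed.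

(** The coupling reads the first [m.*2] letters of a longer word, whereas the auxiliary space has
    words of exactly that length. Consistency removes the surplus, and [integral_word_density]
    equates the masses word by word. *)
Lemma coupling_w_law : w_law (2 * lam) (P := coupling_measure) coupling_w.
Proof.
exists _, (n.+1.-tuple R * word_space n)%type, (w_measure lam_gt0).
exists (@w_xi R n), (@w_edges R n); split.
- by move=> i B; exact: w_xi_law.
- exact: w_xi_independent.
- exact: w_conditionally_poisson.
move=> A; apply: etrans (coupling_measureE (coupling_w @^-1` A)) _.
apply: etrans (esym (word_mixtureE double (fun=> w_piece lam_gt0)
  [set z | A (word_w_multigraph (z.2 : seq 'I_n.+1))])).
apply: eq_eseriesr => m _.
pose g (u : seq 'I_n.+1) : R := (word_w_multigraph u \in A)%:R.
transitivity (edge_number_prob m * polya_mean m.*2 g)%:E.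
  have mL : (m.*2 <= word_length m)%N by exact: leq_maxr.
  by rewrite -(polya_mean_take _ mL).
rewrite mulr_sumr -sumEFin; apply: eq_bigr => u _.
rewrite /w_piece/= /pushforward /mdensity /=.
rewrite (_ : _ @^-1` _ = [set _ | A (word_w_multigraph u)]); last first.
  by apply/seteqP; split.
rewrite /g; have [uA|uA] := boolP (word_w_multigraph u \in A); last first.
  rewrite mulr0 mulr0 (_ : [set _ | _] = set0) ?integral_set0//.
  by apply/seteqP; split => // t /=; rewrite -in_setE (negbTE uA).
rewrite (_ : [set _ | _] = setT); last first.
  by apply/seteqP; split => // t _ /=; rewrite -in_setE.
rewrite (integral_word_density lam_gt0 (m := m)) ?size_tuple//.
by rewrite edge_number_probE -EFinM mulr1 mulrC.
Qed.

End coupling.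

(** * The expected distance *)

Section expected_distance.
Context (R : realType) (n : nat).
Implicit Types (F : seq 'I_n.+1 -> R).

(** By exchangeability the word may be rotated by [lo], which brings the window to the front. *)
Lemma polya_mean_window L lo k F : (lo + k <= L)%N ->
  polya_mean L (fun u => F (take k (drop lo u))) = polya_mean k F.
Proof.
move=> lokL; rewrite -(polya_mean_take F (leq_trans (leq_addl lo k) lokL)).
rewrite [RHS](polya_mean_rot _ lo); apply: eq_polya_mean => u uL /=.
by rewrite /rot takel_cat// size_drop uL leq_subRL// (leq_trans _ lokL)// leq_addr.
Qed.

(** Truncation at a level [a]: bounding the power of one entry by the sum over all vertices gives a
    bound on the maximum, whose mean involves only moments. *)
Lemma le_add_power (x a : R) k : 0 <= x -> 0 < a -> x <= a + x ^+ k.+1 / a ^+ k.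
Proof.
move=> x0 a0; have [xa|ax] := leP x a.
  by rewrite (le_trans xa)// lerDl divr_ge0// exprn_ge0// ltW.
rewrite (@le_trans _ _ (x ^+ k.+1 / a ^+ k))//; last by rewrite lerDr ltW.
rewrite ler_pdivlMr ?exprn_gt0// exprS ler_wpM2l//.
by rewrite lerXn2r// ?nnegrE ltW// (lt_trans a0).
Qed.

Lemma polya_mean_loop_sqr_le m (v : 'I_n.+1) :
  polya_mean m.*2 (fun u => (loop_count v u)%:R ^+ 2 : R) <=
  24 * (m%:R / n.+1%:R ^+ 2) ^+ 2 + 2 * (m%:R / n.+1%:R ^+ 2).
Proof.
have r_ge k : n.+1%:R ^+ k <= rising R k n.+1.
  rewrite -{1}(card_ord k) -prodr_const; apply: ler_prod => j _.
  by rewrite ler0n ler_nat leq_addr.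
have n0 k : 0 < n.+1%:R ^+ k :> R by rewrite exprn_gt0.
rewrite polya_mean_loop_sqr lerD//.
  apply: (@le_trans _ _ (24 * (m%:R * m%:R) / n.+1%:R ^+ 4)); last first.
    by rewrite le_eqVlt; apply/orP; left; apply/eqP; field; rewrite nat1r pnatr_eq0.
  rewrite -!mulrA ler_wpM2l//.
  (* At [m = 0] the factor [m%:R - 1] is negative, and the product of inequalities would not
     apply. *)
  case: m => [|m]; first by rewrite !mul0r.
  rewrite mulrA [leRHS]mulrA ler_pM ?invr_ge0 ?mulr_ge0 ?subr_ge0 ?ler1n//.
  - by rewrite ltW// rising_gt0.
  - by rewrite ler_wpM2l// gerBl.
  - by rewrite lef_pV2 ?posrE ?n0 ?rising_gt0// r_ge.
rewrite -mulrA ler_wpM2l// ler_wpM2l//.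
by rewrite lef_pV2 ?posrE ?n0 ?rising_gt0// r_ge.
Qed.

Lemma polya_mean_jumble_dist L N m k (a b q : R) : (N <= L)%N -> (m.*2 <= L)%N ->
  0 < a -> 0 < b ->
  k = ((maxn N./2 m).*2 - (minn N./2 m).*2)%N -> q = N./2%:R / n.+1%:R ^+ 2 ->
  polya_mean L (fun u : seq 'I_n.+1 => jumble_dist R (pag_multigraph N (nth ord0 u))
    (word_w_multigraph (take m.*2 u))) <=
  n.+1%:R^-1 * (a + n.+1%:R * (720 * (1 + k%:R / n.+1%:R) ^+ 6) / a ^+ 5 +
                (b + n.+1%:R * (24 * q ^+ 2 + 2 * q) / b)).
Proof.
move=> NL mL a0 b0 kE qE; set lo := (minn N./2 m).*2 in kE *.
have NN : (N./2.*2 <= N)%N by rewrite -[leqRHS]odd_double_half leq_addl.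
have lokL : (lo + k <= L)%N.
  rewrite kE subnKC ?leq_double ?geq_min ?leq_max ?leqnn//.
  by case: (leqP N./2 m) => // _; exact: leq_trans NL.
pose W i (u : seq 'I_n.+1) : R := (count_mem i (take k (drop lo u)))%:R.
pose Z i (u : seq 'I_n.+1) : R := (loop_count i (take N./2.*2 u))%:R.
apply: (@le_trans _ _ (polya_mean L (fun u => n.+1%:R^-1 *
    ((a + a^-1 ^+ 5 * \sum_i W i u ^+ 6) + (b + b^-1 * \sum_i Z i u ^+ 2))))).
  apply: le_polya_mean => u uL; apply: jumble_dist_le => [|i].
    by rewrite !addr_ge0 ?mulr_ge0 ?exprn_ge0 ?sumr_ge0 ?invr_ge0
      ?(ltW a0) ?(ltW b0)// => i _; rewrite exprn_ge0.
  apply: (le_trans (row_dist_le _ _ _ _)); rewrite ?uL// -/lo -kE.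
  apply: lerD.
    apply: (le_trans (le_add_power 5 (ler0n _ _) a0)).
    rewrite lerD2l mulrC -exprVn ler_wpM2l ?exprn_ge0 ?invr_ge0 ?(ltW a0)//.
    by rewrite (bigD1 i)//= lerDl sumr_ge0// => j _; rewrite exprn_ge0.
  apply: (le_trans (le_add_power 1 (ler0n _ _) b0)).
  rewrite lerD2l mulrC expr1 ler_wpM2l ?invr_ge0 ?(ltW b0)//.
  by rewrite (bigD1 i)//= lerDl sumr_ge0// => j _; rewrite exprn_ge0.
rewrite polya_meanZ ler_wpM2l ?invr_ge0// !polya_meanD !polya_mean_cst.
rewrite !polya_meanZ !polya_mean_sum.
have sum_le (f : 'I_n.+1 -> R) (B : R) : (forall i, f i <= B) ->
    \sum_i f i <= n.+1%:R * B.
  move=> fB; rewrite -[n.+1 in leRHS]card_ord mulr_natl -sumr_const.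
  exact: ler_sum.
rewrite exprVn [_^-1 * _]mulrC [b^-1 * _]mulrC; apply: lerD; rewrite lerD2l.
  rewrite ler_wpM2r ?invr_ge0 ?exprn_ge0 ?(ltW a0)//; apply: sum_le => i.
  rewrite (polya_mean_window (fun u => (count_mem i u)%:R ^+ 6) lokL).
  exact: polya_mean_count6.
rewrite ler_wpM2r ?invr_ge0 ?(ltW b0)//; apply: sum_le => i.
rewrite (polya_mean_take (fun u => (loop_count i u)%:R ^+ 2)).
  by rewrite qE; exact: polya_mean_loop_sqr_le.
exact: leq_trans NL.
Qed.

End expected_distance.

Section coupling_distance.
Context (R : realType) (n : nat) (lam : R).
Hypothesis lam_gt0 : (0 < lam)%R.
Local Notation N := (Num.truncn (2 * lam * n.+1%:R ^+ 2)).
Local Notation mu := (lam * n.+1%:R ^+ 2).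

(* In terms of the sixth root r of the number of vertices, all the rates are
   integer powers. *)
Variable r : R.
Hypotheses (r_ge1 : 1 <= r) (r6 : r ^+ 6 = n.+1%:R).

Let r_gt0 : 0 < r. Proof. exact: lt_le_trans r_ge1. Qed.

Let mu_ge0 : 0 <= mu. Proof. by rewrite mulr_ge0 ?exprn_ge0// ltW. Qed.

(** Truncating [2 * mu] to [N] and rounding half of [N] down each lose at most half an edge. *)
Let half_truncn : mu - 1 <= N./2%:R <= mu.
Proof.
have N2 : 0 <= 2 * lam * n.+1%:R ^+ 2 by rewrite -mulrA mulr_ge0.
have /andP[Nle ltN] := truncn_itv N2.
have e : N%:R = (odd N)%:R + 2 * N./2%:R :> R.
  by rewrite -{1}(odd_double_half N) natrD -mul2n natrM.
have /andP[odd0 odd1] : (0 <= (odd N)%:R :> R) && ((odd N)%:R <= 1 :> R).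
  by case: (odd N); rewrite ?lexx ler01.
rewrite -natr1 in ltN; apply/andP; split; lra.
Qed.

Lemma polya_mean_coupling_distance m :
  polya_mean (word_length n lam m) (fun u =>
    jumble_dist R (coupling_pag lam ((m, u) : coupling_space n))
      (coupling_w ((m, u) : coupling_space n))) <=
  (721 * 4 + 1 + (24 * lam ^+ 2 + 2 * lam)) / r ^+ 2 +
  1442 / r ^+ 20 * (m%:R - mu) ^+ 2.
Proof.
set x : R := m%:R - mu.
set k := ((maxn N./2 m).*2 - (minn N./2 m).*2)%N.
set q : R := N./2%:R / n.+1%:R ^+ 2.
have n0 : 0 < n.+1%:R ^+ 2 :> R by rewrite exprn_gt0.
have /andP[Nge Nle] := half_truncn.
have q0 : 0 <= q by rewrite divr_ge0// exprn_ge0.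
have ql : q <= lam by rewrite ler_pdivrMr.
have k0 : 0 <= k%:R :> R by [].
have kE : k%:R = 2 * `|m%:R - N./2%:R| :> R.
  rewrite /k -doubleB -mul2n natrM; congr (_ * _).
  case: (leqP N./2 m) => h; first by rewrite natrB// ger0_norm// subr_ge0 ler_nat.
  by rewrite natrB ?(ltnW h)// distrC ger0_norm// subr_ge0 ler_nat ltnW.
(* With this level the sum of the sixth moments divided by [a ^ 5] is 720 times [a], whence 721
   below. The level [r ^ 3], the square root of the number of vertices, balances the loop terms in
   the same way. *)
have a0 : 0 < r * (1 + k%:R / n.+1%:R).
  by rewrite mulr_gt0// ltr_pwDl// divr_ge0.
have b0 : 0 < r ^+ 3 by rewrite exprn_gt0.
apply: (le_trans (polya_mean_jumble_dist (leq_maxl _ _) (leq_maxr _ _) a0 b0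
  (erefl k) (erefl q))).
have kd0 : 1 + k%:R / n.+1%:R != 0 :> R.
  by rewrite gt_eqF// ltr_pwDl// divr_ge0.
have r0 : r != 0 by rewrite gt_eqF.
rewrite -r6 in kd0 *.
have -> : (r ^+ 6)^-1 * (r * (1 + k%:R / r ^+ 6) +
    r ^+ 6 * (720 * (1 + k%:R / r ^+ 6) ^+ 6) / (r * (1 + k%:R / r ^+ 6)) ^+ 5 +
    (r ^+ 3 + r ^+ 6 * (24 * q ^+ 2 + 2 * q) / r ^+ 3)) =
    721 / r ^+ 5 + 721 / r ^+ 11 * k%:R + (1 + (24 * q ^+ 2 + 2 * q)) / r ^+ 3.
  set y := 1 + k%:R / r ^+ 6 in kd0 *.
  have -> : k%:R = (y - 1) * r ^+ 6 by rewrite /y; field.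
  clearbody y; field.
  by rewrite kd0 r0.
have rX_le i j : (i <= j)%N -> (r ^+ j)^-1 <= (r ^+ i)^-1.
  move=> ij; rewrite lef_pV2 ?posrE ?exprn_gt0//.
  by rewrite ler_weXn2l.
have r_pos i : 0 < (r ^+ i)^-1 by rewrite invr_gt0 exprn_gt0.
have q_le : 24 * q ^+ 2 + 2 * q <= 24 * lam ^+ 2 + 2 * lam.
  by rewrite lerD// ler_wpM2l// lerXn2r// ?nnegrE// ltW.
(* The inequality 2 |d| <= d^2 / r^9 + r^9, at the typical size r^9 = n^(3/2) of the deviation,
   replaces [k] by a square, to which the variance bound applies. *)
have k_le : k%:R <= 2 * x ^+ 2 / r ^+ 9 + (2 / r ^+ 9 + r ^+ 9).
  pose d : R := m%:R - N./2%:R.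
  have d2 : d ^+ 2 <= 2 * x ^+ 2 + 2.
    have e1 : 0 <= mu - N./2%:R <= 1 by apply/andP; split; lra.
    have : (mu - N./2%:R) ^+ 2 <= 1 by case/andP: e1 => e1 e2; rewrite expr_le1.
    have -> : d = x + (mu - N./2%:R) by rewrite /d /x; ring.
    move: (mu - _) => e h; have := sqr_ge0 (x - e); nra.
  have r90 : 0 < r ^+ 9 by rewrite exprn_gt0.
  apply: (@le_trans _ _ (d ^+ 2 / r ^+ 9 + r ^+ 9)).
    rewrite kE -/d -(ler_pM2r r90) [leRHS]mulrDl divfK ?gt_eqF//.
    have := sqr_ge0 (`|d| - r ^+ 9); rewrite sqrrB real_normK ?num_real//.
    lra.
  rewrite addrA lerD2r -mulrDl ler_wpM2r// ltW//.
have key : 721 / r ^+ 11 * k%:R <= 1442 / r ^+ 20 * x ^+ 2 + 721 * 3 / r ^+ 2.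
  apply: (@le_trans _ _
      (721 / r ^+ 11 * (2 * x ^+ 2 / r ^+ 9 + (2 / r ^+ 9 + r ^+ 9)))).
    by apply: ler_wpM2l k_le; apply: divr_ge0; [exact: ler0n|exact/ltW/exprn_gt0].
  have -> : 721 / r ^+ 11 * (2 * x ^+ 2 / r ^+ 9 + (2 / r ^+ 9 + r ^+ 9)) =
      1442 / r ^+ 20 * x ^+ 2 + (1442 / r ^+ 20 + 721 / r ^+ 2) by field.
  rewrite lerD2l; have := rX_le 2 20 isT; lra.
have h5 := rX_le 2 5 isT.
have h3 : (1 + (24 * q ^+ 2 + 2 * q)) / r ^+ 3 <=
    (1 + (24 * lam ^+ 2 + 2 * lam)) / r ^+ 2.
  apply: ler_pM => //; first by rewrite addr_ge0// addr_ge0 ?mulr_ge0 ?exprn_ge0.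
  - by rewrite ltW.
  - by rewrite lerD2l.
  - exact: rX_le.
rewrite [leRHS](_ : _ = 721 / r ^+ 2 + (1442 / r ^+ 20 * x ^+ 2 + 721 * 3 / r ^+ 2) +
    (1 + (24 * lam ^+ 2 + 2 * lam)) / r ^+ 2); last by field.
by apply: lerD h3; apply: lerD key; apply: ler_wpM2l h5; exact: ler0n.
Qed.

(** The last summand comes from the variance: it is of order [r ^ 18], and with the factor
    [1442 / r ^ 20] it leaves [r ^ -2] like the terms free of [m]. *)
Definition distance_bound : R :=
  721 * 4 + 1 + (24 * lam ^+ 2 + 2 * lam) + 1442 * (21 * lam ^+ 2 + 2 * lam).

Lemma expected_coupling_distance :
  (\int[coupling_measure (n := n) lam_gt0]_z
    (jumble_dist R (coupling_pag lam z) (coupling_w z))%:E <=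
  (distance_bound / r ^+ 2)%:E)%E.
Proof.
have J0 (z : coupling_space n) : 0 <= jumble_dist R (coupling_pag lam z) (coupling_w z).
  by rewrite mulr_ge0 ?invr_ge0// bigmax_ge_id.
rewrite ge0_integral_coupling_measure//.
set p := edge_number_prob n lam.
have p0 m : 0 <= p m by exact: edge_number_prob_ge0.
set K := 721 * 4 + 1 + (24 * lam ^+ 2 + 2 * lam).
have lam2 : 0 <= lam ^+ 2 by exact: sqr_ge0.
have K0 : 0 <= K.
  by rewrite /K; have := ltW lam_gt0; lra.
have Kr : 0 <= K / r ^+ 2 by rewrite divr_ge0// exprn_ge0// ltW.
have [c20 c20E] : exists x, x = 1442 / r ^+ 20 by exists (1442 / r ^+ 20).
have Cr : 0 <= c20.
  by rewrite c20E; apply: divr_ge0; [exact: ler0n|exact/ltW/exprn_gt0].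
apply: (@le_trans _ _ (\sum_(m <oo) ((K / r ^+ 2)%:E * (p m)%:E +
    c20%:E * (edge_number_pmf n lam m * ((m%:R - mu) ^+ 2)%:E)))%E).
  apply: lee_nneseries => [m _ _|m _].
    by rewrite lee_fin mulr_ge0 ?p0// polya_mean_ge0.
  rewrite edge_number_probE// -!EFinM -EFinD lee_fin.
  apply: (le_trans (ler_wpM2l (p0 m) (polya_mean_coupling_distance m))).
  by rewrite le_eqVlt; apply/orP; left; apply/eqP; rewrite c20E -/K -/p; ring.
rewrite nneseriesD; last 2 first.
- by move=> m _ _; rewrite -EFinM lee_fin mulr_ge0.
- move=> m _ _; rewrite edge_number_probE// -!EFinM lee_fin.
  by apply: mulr_ge0 => //; apply: mulr_ge0; [exact: p0|exact: sqr_ge0].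
rewrite nneseriesZl; last by move=> m _; rewrite lee_fin.
rewrite nneseriesZl; last first.
  by move=> m _; rewrite edge_number_probE// -EFinM lee_fin mulr_ge0// sqr_ge0.
rewrite sum_edge_number_prob// mule1.
apply: (le_trans (leeD2l _ (lee_wpmul2l _ (@edge_number_variance R n lam lam_gt0)))).
  by rewrite lee_fin.
rewrite -EFinM -EFinD lee_fin c20E /distance_bound -/K -r6 -exprM /=.
have r0 : r != 0 by rewrite gt_eqF.
by rewrite le_eqVlt; apply/orP; left; apply/eqP; field.
Qed.

End coupling_distance.

(** The increasing branch [a - 2] and the decreasing branch [(1 - a) / 2] meet at 5/3 with the value
    -1/3, so one of them is at least -1/3 everywhere. *)
Lemma beta_exponent_ge (R : realType) (a : R) : - (1 / 3) <= beta_exponent a.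
Proof.
rewrite /beta_exponent !le_max; have [a53|a53] := leP (5 / 3) a.
  by apply/orP; left; apply/orP; left; lra.
by apply/orP; left; apply/orP; right; lra.
Qed.

Lemma beta_exponent53 (R : realType) : beta_exponent (5 / 3 : R) = - (1 / 3).
Proof.
apply/eqP; rewrite eq_le beta_exponent_ge andbT /beta_exponent !ge_max.
by apply/andP; split; apply/andP; split; lra.
Qed.

Lemma beta_exponent_le53 (R : realType) (a : R) :
  beta_exponent a <= - (1 / 3) -> a = 5 / 3.
Proof.
rewrite /beta_exponent !ge_max => /andP[/andP[h1 h2] _].
by apply/eqP; rewrite eq_le; apply/andP; split; lra.
Qed.

Lemma exists_coupling (R : realType) (lam : R) : 0 < lam ->
  exists (d : nat -> measure_display) (T : forall n, measurableType (d n))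
    (P : forall n, probability (T n) R)
    (G H : forall n, {RV (P n) >-> multigraph n}),
    (forall n, (1 <= n)%N -> pag_law (2 * lam) (G n) /\ w_law (2 * lam) (H n)) /\
    (forall n, (1 <= n)%N ->
      ('E_(P n)[fun x => jumble_dist R (G n x) (H n x)] <=
       (distance_bound lam * n%:R `^ (- (1 / 3)))%:E)%E).
Proof.
move=> lam0.
exists (fun=> default_measure_display), (fun n => coupling_space n.-1).
exists (fun n => coupling_measure (n := n.-1) lam0).
(* The construction has [n.+1] vertices; the value at 0 is a filler, as the claims start at
   [n = 1]. *)
exists (fun n => match n return
    {RV (coupling_measure (n := n.-1) lam0) >-> multigraph n} with
  | 0 => cst (empty_multigraph 0) | n'.+1 => @coupling_pag R n' lam end).
exists (fun n => match n return
    {RV (coupling_measure (n := n.-1) lam0) >-> multigraph n} with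
  | 0 => cst (empty_multigraph 0) | n'.+1 => @coupling_w n' end).
split => [[//|n] _|[//|n] _].
  by split; [exact: coupling_pag_law|exact: coupling_w_law].
have n1 : 1 <= n.+1%:R :> R by rewrite ler1n.
pose r : R := n.+1%:R `^ (1 / 6).
have r1 : 1 <= r by rewrite -(powRr0 n.+1%:R) ler_powR.
have r6 : r ^+ 6 = n.+1%:R.
  by rewrite -powR_mulrn ?powR_ge0// -powRrM div1r mulVf ?pnatr_eq0// powRr1.
have -> : n.+1%:R `^ (- (1 / 3)) = (r ^+ 2)^-1 :> R.
  rewrite powRN -powR_mulrn ?powR_ge0// -powRrM; congr (_ `^ _)^-1.
  by field.
rewrite unlock; exact: (expected_coupling_distance lam0 r1 r6).
Qed.

Theorem theorem1 (R : realType) :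
  (forall c : R, 0 < c ->
    exists (d : nat -> measure_display) (T : forall n, measurableType (d n))
      (P : forall n, probability (T n) R)
      (G H : forall n, {RV (P n) >-> multigraph n}),
      (forall n, (1 <= n)%N -> pag_law c (G n) /\ w_law c (H n)) /\
      (forall a : R, 1 < a < 2 ->
        exists K : R, 0 < K /\
          forall n, (2 <= n)%N ->
            ('E_(P n)[fun x => jumble_dist R (G n x) (H n x)]
             <= (K * ln n%:R ^+ 2 * n%:R `^ beta_exponent a)%:E)%E)) /\
  (forall a : R, 1 < a < 2 ->
    (forall b : R, 1 < b < 2 -> beta_exponent a <= beta_exponent b) <->
    a = 5 / 3) /\
  beta_exponent (5 / 3 : R) = - (1 / 3).
Proof.
split; last split; last exact: beta_exponent53.
- move=> c c0; have [lam lam0 ->] : exists2 lam, 0 < lam & c = 2 * lam.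
    by exists (c / 2); [rewrite divr_gt0|field].
  have [d [T [P [G [H [laws dist]]]]]] := exists_coupling lam0.
  exists d, T, P, G, H; split=> // a _.
  have D0 : 0 < distance_bound lam.
    by have := sqr_ge0 lam; rewrite /distance_bound; lra.
  have ln2 : 0 < ln 2 ^+ 2 :> R by rewrite exprn_gt0// ln_gt0// ltr1n.
  (* Since [ln n] is at least [ln 2], this constant absorbs the logarithms. It is the same for every
     [a], because no exponent [beta_exponent a] is below -1/3. *)
  exists (distance_bound lam / ln 2 ^+ 2); split; first by rewrite divr_gt0.
  move=> n n2; apply: (le_trans (dist n (ltnW n2))); rewrite lee_fin.
  have n1 : 1 <= n%:R :> R by rewrite ler1n ltnW.
  apply: ler_pM; [exact: ltW|exact: powR_ge0| |].
    rewrite mulrAC ler_pdivlMr// ler_wpM2l ?(ltW D0)//.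
    rewrite lerXn2r ?nnegrE ?ln_ge0// ?ler1n//.
    by rewrite ler_ln ?posrE ?ler_nat// ltr0n ltnW.
  by rewrite ler_powR// beta_exponent_ge.
- move=> a _; split => [amin|-> b _].
    apply: beta_exponent_le53; rewrite -beta_exponent53; apply: amin.
    by apply/andP; split; lra.
  by rewrite beta_exponent53 beta_exponent_ge.
Qed.
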